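(* Let $t_n=\frac{3}{4}n\log n-\frac{1}{4}n\log\log n-c_n n$ be a sequence of natural numbers with $\lim_{n\to\infty}c_n=\infty$. Then $\lim_{n\to\infty}d_n(t_n)=1$, where $$d_n(t)=\max_{\sigma\in S_n}\left\Vert \mathbb{P}^n_\sigma(\Pi_t\in\cdot)-\mathbb{U}^n\right\Vert_{TV}.$$
   Context: The random-to-random insertions shuffle on a deck of $n$ cards numbered $1,\dots,n$: at each step a card is chosen uniformly at random, removed from the deck, and reinserted at a uniformly random position (among the $n$ positions). An ordering of the deck is identified with the permutation $\sigma\in S_n$ such that $\sigma(j)$ is the position of card $j$. The shuffle induces a random walk $\Pi_t$, $t=0,1,\dots$, on $S_n$, and $\mathbb{P}^n_\sigma$ denotes the law of this walk started from $\Pi_0=\sigma$. $\mathbb{U}^n$ denotes the uniform measure on $S_n$ and $\|\cdot\|_{TV}$ the total variation distance. $\log$ is the natural logarithm. *)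

(* Defs.v *)
From HB Require Import structures.
From mathcomp Require Import all_boot all_order all_algebra all_fingroup.
From mathcomp Require Import all_classical all_reals all_analysis.
Set Implicit Arguments. Unset Strict Implicit. Unset Printing Implicit Defensive.
Import Order.TTheory GRing.Theory Num.Theory.
Local Open Scope ring_scope.

(* A deck ordering is sigma : {perm 'I_n}, sigma j = position of card j.
   Removing the card at position a and reinserting it at position p moves
   a card at position q to the position [reinsert a p q]. *)
Definition reinsert (n : nat) (a p q : 'I_n) : nat :=
  if q == a then val p
  else let q' := if (a < q)%N then (val q).-1 else val q in
       if (p <= q')%N then q'.+1 else q'.

Section RTR.
Variable R : realType.

(* one-step transition probability of random-to-random insertions:
   card j and position p are chosen independently and uniformly. *)
Definition rtr_kernel (n : nat) (s u : {perm 'I_n}) : R :=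
  (#|[set jp : 'I_n * 'I_n |
      [forall k : 'I_n, val (u k) == reinsert (s jp.1) jp.2 (s k)]]|)%:R
  / (n ^ 2)%:R.

Fixpoint rtr_law (n : nat) (s : {perm 'I_n}) (t : nat) : {perm 'I_n} -> R :=
  match t with
  | O => fun u => (u == s)%:R
  | t'.+1 => fun u => \sum_(v : {perm 'I_n}) rtr_law s t' v * rtr_kernel v u
  end.

Definition tv_to_unif (n : nat) (mu : {perm 'I_n} -> R) : R :=
  2^-1 * \sum_(u : {perm 'I_n}) `|mu u - (#|{perm 'I_n}|%:R)^-1|.

Definition rtr_dist (n t : nat) : R :=
  \big[Num.max/0]_(s : {perm 'I_n}) tv_to_unif (rtr_law s t).

End RTR.

(* Main.v *)
(* Let u be the number of untouched cards after t steps; E u = M = n (1 - 1/n)^t.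
   They all lie within w >> sqrt t of their starting position, whereas under the
   uniform law the number of cards displaced by at most w fluctuates by about
   sqrt w, which is << M when w = e^(c/2) sqrt(n log n).  So the centred number
   of such cards, [stat], separates the two laws by the second moment method.

   What has to be excluded is that the touched cards hide the excess.  A touched
   card has an exactly uniform position, and the covariances of pairs of touched
   cards add up to O(w).  To see this, look at the last time one card of a pair
   (i, j) of touched cards is chosen: it goes to a uniform place, and only the
   rank of the other card in the rest of the deck is not quite uniform, by a
   discrete gradient of total size 1/n.  It therefore suffices that the pair
   chain conditioned to touch neither card does not increase Lipschitz norms,
   summed over all pairs (i, j), which is a path coupling argument. *)

Require Import Defs.
From HB Require Import structures.
From mathcomp Require Import all_boot all_order all_algebra all_fingroup.
From mathcomp Require Import all_classical all_reals all_analysis.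
From mathcomp Require Import zify ring lra.
Import Order.TTheory GRing.Theory Num.Theory.
Import numFieldNormedType.Exports.
Local Open Scope classical_set_scope.
Local Open Scope ring_scope.

(* [pull a x] is the position of the card at [x] once the card at [a <> x] is
   removed, and [push p z] that of the card at [z] once a card is inserted at [p]. *)
Definition pull (a x : nat) : nat := x - (a < x).
Definition push (p z : nat) : nat := z + (p <= z).

(** * Reinsertion as a permutation of the positions *)

Lemma reinsertE n (a p x : 'I_n) :
  reinsert a p x = if x == a then val p else push p (pull a x).
Proof.
rewrite /reinsert /push /pull; case: eqP => // _ /=.
by case: (ltnP a x) => _; case: (leqP p _); rewrite ?subn1 ?subn0; lia.
Qed.

Lemma reinsert_lt n (a p x : 'I_n) : (reinsert a p x < n)%N.
Proof.
rewrite reinsertE /push /pull -val_eqE /=; case: (eqVneq (x : nat) a) => [_|] //.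
have := ltn_ord x; have := ltn_ord a; have := ltn_ord p; lia.
Qed.

Definition reinsert_ord n (a p x : 'I_n) : 'I_n := Ordinal (reinsert_lt n a p x).

Lemma reinsert_ord_inj n (a p : 'I_n) : injective (reinsert_ord n a p).
Proof.
move=> x y /(congr1 val) /=; rewrite !reinsertE /push /pull -!val_eqE /= => h.
apply/val_inj => /=; move: h.
case: (eqVneq (x : nat) a) => [-> //|hx]; case: (eqVneq (y : nat) a) => [-> //|hy]; lia.
Qed.

Definition reinsert_perm n (a p : 'I_n) : {perm 'I_n} := perm (@reinsert_ord_inj n a p).

Lemma reinsert_permE n (a p x : 'I_n) : (reinsert_perm n a p x : nat) = reinsert a p x.
Proof. by rewrite permE. Qed.

Lemma reinsert_perm_self n (a p : 'I_n) : reinsert_perm n a p a = p.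
Proof. by apply/val_inj; rewrite /= reinsert_permE reinsertE eqxx. Qed.

Lemma reinsert_perm_neq n (a p x : 'I_n) : a != x -> (reinsert_perm n a p x : nat) = push p (pull a x).
Proof. by move=> h; rewrite reinsert_permE reinsertE eq_sym (negbTE h). Qed.

(** * Expectations along the walk, with a record of the chosen cards *)

Section Walk.
Context {R : realType} {n : nat}.
Implicit Types (s v : {perm 'I_n}) (A : {set 'I_n}).
Implicit Types (H : {perm 'I_n} -> {set 'I_n} -> R).

Definition inv_sq : R := (n ^ 2)%:R^-1.

(* The second argument of [H] records the set of cards chosen so far. *)
Definition step_avg H v A : R :=
  inv_sq * \sum_(j : 'I_n) \sum_(p : 'I_n) H (v * reinsert_perm n (v j) p)%g (j |: A).

(** The expectation of [H] at time [t] from the start [s]. The transition operator is iterated on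
    [H], so that [avgS] splits off the last step of the walk. *)
Definition avg s t H : R := iter t step_avg H s finset.set0.

Lemma avgS s t H : avg s t.+1 H = avg s t (step_avg H).
Proof. by rewrite /avg iterSr. Qed.

Lemma eq_avg s t H H' : (forall v A, H v A = H' v A) -> avg s t H = avg s t H'.
Proof. by move=> h; congr avg; do 2 apply/funext => ?; exact: h. Qed.

Lemma inv_sq_ge0 : 0 <= inv_sq. Proof. by rewrite invr_ge0 ler0n. Qed.

Lemma avg_le s t H H' : (forall v A, H v A <= H' v A) -> avg s t H <= avg s t H'.
Proof.
elim: t H H' => [|t IH] H H' h; first exact: h.
rewrite !avgS; apply: IH => v A; apply: ler_wpM2l; first exact: inv_sq_ge0.
by do 2 (apply: ler_sum => ? _); exact: h.
Qed.

Lemma avgD s t H H' : avg s t (fun v A => H v A + H' v A) = avg s t H + avg s t H'.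
Proof.
elim: t H H' => // t IH H H'; rewrite !avgS -IH; apply: eq_avg => v A.
by rewrite /step_avg -mulrDr -big_split; congr (_ * _); apply: eq_bigr => j _; rewrite -big_split.
Qed.

Lemma avgZ s t a H : avg s t (fun v A => a * H v A) = a * avg s t H.
Proof.
elim: t H => // t IH H; rewrite !avgS -IH; apply: eq_avg => v A.
rewrite /step_avg mulrCA; congr (_ * _); rewrite mulr_sumr; apply: eq_bigr => j _.
by rewrite mulr_sumr.
Qed.

Lemma avg0 s t : avg s t (fun _ _ => 0) = 0.
Proof.
transitivity (0 * avg s t (fun _ _ => 0)); last exact: mul0r.
by rewrite -avgZ; apply: eq_avg => v A; rewrite mul0r.
Qed.

Lemma avg_sum s t (I : Type) (r : seq I) (P : pred I) (H : I -> _ -> _ -> R) :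
  avg s t (fun v A => \sum_(i <- r | P i) H i v A) = \sum_(i <- r | P i) avg s t (H i).
Proof.
elim: r => [|i r IH].
  rewrite big_nil; transitivity (avg s t (fun _ _ => 0)); last exact: avg0.
  by apply: eq_avg => v A; rewrite big_nil.
rewrite big_cons; case: ifP => Pi.
  by rewrite -IH -avgD; apply: eq_avg => v A; rewrite big_cons Pi.
by rewrite -IH; apply: eq_avg => v A; rewrite big_cons Pi.
Qed.

Lemma ler_norm_avg s t H : `|avg s t H| <= avg s t (fun v A => `|H v A|).
Proof.
rewrite ler_norml -mulN1r -avgZ; apply/andP; split; apply: avg_le => v A.
  by rewrite mulN1r lerNl ler_normr lexx orbT.
exact: ler_norm.
Qed.

Lemma avg_const s t a : (0 < n)%N -> avg s t (fun _ _ => a) = a.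
Proof.
move=> n0; elim: t => // t IH; rewrite avgS -[RHS]IH; apply: eq_avg => v A.
rewrite /step_avg !sumr_const !card_ord -mulrnA mulnn -mulr_natl mulrA.
by rewrite mulVf ?mul1r // pnatr_eq0 expn_eq0 andbT -lt0n.
Qed.

Lemma kernelE v w :
  rtr_kernel R v w = inv_sq * \sum_(j : 'I_n) \sum_(p : 'I_n) ((v * reinsert_perm n (v j) p)%g == w)%:R.
Proof.
rewrite /rtr_kernel mulrC; congr (_ * _).
rewrite pair_big /= -natr_sum -sum1_card big_mkcond /=; congr (_%:R).
apply: eq_bigr => -[j p] _ /=; rewrite inE /=; case: forallP => h.
  suff -> : (v * reinsert_perm n (v j) p)%g = w by rewrite eqxx.
  by apply/permP => k; apply/val_inj; rewrite /= permM reinsert_permE (eqP (h k)).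
case: eqP => // e; case: h => k; rewrite -e permM /= reinsert_permE; exact: eqxx.
Qed.

(** Duality: the law evolves forwards in time, while [avg] moves the same kernel onto the test
    function. *)
Lemma lawE s t (f : {perm 'I_n} -> R) :
  \sum_u rtr_law R s t u * f u = avg s t (fun v _ => f v).
Proof.
elim: t f => [|t IH] f /=.
  rewrite /avg /= (bigD1 s) //= eqxx mul1r big1 ?addr0 // => u /negbTE ->.
  by rewrite mul0r.
rewrite avgS.
transitivity (\sum_v rtr_law R s t v * \sum_u rtr_kernel R v u * f u).
  under eq_bigr do rewrite mulr_suml.
  rewrite exchange_big /=; apply: eq_bigr => v _; rewrite mulr_sumr.
  by apply: eq_bigr => u _; rewrite mulrA.
rewrite IH; apply: eq_avg => v A; rewrite /step_avg.
under eq_bigr do rewrite kernelE -mulrA mulr_suml.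
rewrite -mulr_sumr exchange_big /=; congr (_ * _); apply: eq_bigr => j _.
under eq_bigr do rewrite mulr_suml.
rewrite exchange_big /=; apply: eq_bigr => p _.
rewrite (bigD1 (v * reinsert_perm n (v j) p)%g) //= eqxx mul1r big1 ?addr0 // => u.
by rewrite eq_sym => /negbTE ->; rewrite mul0r.
Qed.

(** Either card [i] is chosen and lands on a uniform place, or the card at some other place [a] is
    chosen and may shift it. So the status and place of one card form a Markov chain. *)
Lemma step_avg1 (i : 'I_n) (b : bool -> 'I_n -> R) v A :
  step_avg (fun v A => b (i \in A) (v i)) v A =
  inv_sq * (\sum_p b true p
        + \sum_(a | a != v i) \sum_p b (i \in A) (reinsert_perm n a p (v i))).
Proof.
rewrite /step_avg (bigD1 i) //=; congr (_ * (_ + _)).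
  by apply: eq_bigr => p _; rewrite finset.setU11 permM reinsert_perm_self.
rewrite [RHS](reindex_inj (@perm_inj _ v)) /=; apply: eq_big => [j|j ji].
  by rewrite (inj_eq perm_inj).
by apply: eq_bigr => p _; rewrite finset.in_setU1 eq_sym (negbTE ji) permM.
Qed.

Lemma step_avg2 (i j : 'I_n) (b : bool -> bool -> 'I_n -> 'I_n -> R) v A : i != j ->
  step_avg (fun v A => b (i \in A) (j \in A) (v i) (v j)) v A =
  inv_sq * (\sum_p b true (j \in A) p (reinsert_perm n (v i) p (v j))
        + \sum_p b (i \in A) true (reinsert_perm n (v j) p (v i)) p
        + \sum_(a | (a != v i) && (a != v j)) \sum_p
            b (i \in A) (j \in A) (reinsert_perm n a p (v i)) (reinsert_perm n a p (v j))).
Proof.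
move=> ij; rewrite /step_avg (bigD1 i) //= [X in _ + X](bigD1 j) /=; last by rewrite eq_sym.
rewrite addrA; congr (_ * (_ + _ + _)).
- by apply: eq_bigr => p _; rewrite finset.setU11 finset.in_setU1 [j == i]eq_sym (negbTE ij) !permM reinsert_perm_self.
- by apply: eq_bigr => p _; rewrite finset.setU11 finset.in_setU1 (negbTE ij) !permM reinsert_perm_self.
rewrite [RHS](reindex_inj (@perm_inj _ v)) /=; apply: eq_big => [k|k /andP[ki kj]].
  by rewrite !(inj_eq perm_inj).
apply: eq_bigr => p _.
by rewrite !finset.in_setU1 ![_ == k]eq_sym (negbTE ki) (negbTE kj) !permM.
Qed.

End Walk.

Arguments inv_sq : clear implicits.

(** * Status, law and displacement of a single card *)

Section OneCard.
Context {R : realType} {n : nat}.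
Implicit Types (s v : {perm 'I_n}) (A : {set 'I_n}).

Lemma sum_neq1 (f : 'I_n -> R) x : \sum_(a | a != x) f a = \sum_a f a - f x.
Proof. by rewrite [X in _ = X - _](bigD1 x) //= addrAC subrr add0r. Qed.

Lemma sum_neq2 (f : 'I_n -> R) x y : x != y ->
  \sum_(a | (a != x) && (a != y)) f a = \sum_a f a - f x - f y.
Proof.
move=> xy; rewrite [X in _ = X - _ - _](bigD1 x) //= [X in _ = _ + X - _ - _](bigD1 y) /=.
  by ring.
by rewrite eq_sym.
Qed.

Lemma sum_cst (c : R) : \sum_(a : 'I_n) c = n%:R * c.
Proof. by rewrite sumr_const card_ord mulr_natl. Qed.

Lemma sum_ltn (k : nat) : (k <= n)%N -> \sum_(p : 'I_n) (p < k)%N%:R = k%:R :> R.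
Proof.
move=> kn; rewrite -natr_sum; congr (_%:R).
rewrite -(big_mkord xpredT (fun p => nat_of_bool (p < k)%N)) (@big_cat_nat _ _ _ k) //=.
rewrite [X in (_ + X)%N]big_nat_cond [X in (_ + X)%N]big1 => [|p]; last by lia.
rewrite addn0 big_nat_cond (eq_bigr (fun=> 1%N)) => [|p]; last by lia.
by rewrite -big_nat_cond sum_nat_const_nat; lia.
Qed.

Lemma sum_perm_reindex (f : 'I_n -> R) (u : {perm 'I_n}) : \sum_x f (u x) = \sum_x f x.
Proof. by rewrite [RHS](reindex_inj (@perm_inj _ u)). Qed.

Definition stay : R := 1 - n%:R^-1.

Lemma stayE : (0 < n)%N -> (inv_sq R n) * (n%:R * (n%:R - 1)) = stay.
Proof.
move=> n0; have n0' : n%:R != 0 :> R by rewrite pnatr_eq0 -lt0n.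
by rewrite /inv_sq /stay natrX; field.
Qed.

Lemma stay_ge0 : 0 <= stay.
Proof.
rewrite /stay; case: n => [|m]; first by rewrite invr0; lra.
by rewrite subr_ge0 invf_le1 ?ler1n ?ltr0n.
Qed.

Lemma stay_le1 : stay <= 1.
Proof. by rewrite /stay gerBl invr_ge0 ler0n. Qed.

Lemma avg_untouched s t (i : 'I_n) :
  avg s t (fun _ A => (i \notin A)%:R) = stay ^+ t :> R.
Proof.
elim: t => [|t IH]; first by rewrite /avg /= finset.in_set0 expr0.
rewrite avgS exprS -IH -avgZ; apply: eq_avg => v A.
rewrite (step_avg1 i (fun c _ => (~~ c)%:R)) /= big1 // add0r sum_neq1 !sum_cst.
rewrite -stayE; last by case: (i) => ? /(leq_ltn_trans _) ->.
by rewrite !mulrA; ring.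
Qed.

(** One step spares both cards with probability 1 - 2/n, which is [stay ^+ 2] minus 1/n^2. *)
Lemma avg_untouched2 s t (i j : 'I_n) : i != j ->
  avg s t (fun _ A => ((i \notin A) && (j \notin A))%:R) <= stay ^+ (2 * t) :> R.
Proof.
move=> ij; elim: t => [|t IH]; first by rewrite /avg /= !finset.in_set0 expr0.
have n0 : (0 < n)%N by case: (i) => ? /(leq_ltn_trans _) ->.
have n0' : n%:R != 0 :> R by rewrite pnatr_eq0 -lt0n.
rewrite avgS mulnS exprD; apply: (@le_trans _ _ (stay ^+ 2 * avg s t
   (fun _ A => ((i \notin A) && (j \notin A))%:R))); last first.
  by apply: ler_wpM2l => //; rewrite exprn_ge0 ?stay_ge0.
rewrite -avgZ; apply: avg_le => v A.
rewrite (step_avg2 i j (fun c d _ _ => (~~ c && ~~ d)%:R) v A ij) /= big1 //.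
rewrite big1 => [|p _]; last by rewrite andbF.
rewrite !add0r sum_neq2 ?(inj_eq perm_inj) // !sum_cst; set e := (nat_of_bool _)%:R.
have -> : stay ^+ 2 * e = (inv_sq R n) * (n%:R * (n%:R * e) - n%:R * e - n%:R * e) + (inv_sq R n) * e.
  by rewrite /inv_sq /stay natrX; field.
by rewrite lerDl mulr_ge0 ?inv_sq_ge0 ?ler0n.
Qed.

(** For fixed [a] and [p], reinsertion maps the places other than [a] bijectively onto those other
    than [p]. *)
Lemma sum_reinserted (f : 'I_n -> R) :
  \sum_x \sum_(a | a != x) \sum_p f (reinsert_perm n a p x) = n%:R * (n%:R - 1) * \sum_x f x.
Proof.
rewrite (exchange_big_dep xpredT) //=.
transitivity (\sum_(a : 'I_n) (n%:R * (\sum_x f x) - (\sum_x f x))); last first.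
  by rewrite sum_cst; ring.
apply: eq_bigr => a _; rewrite exchange_big /=.
transitivity (\sum_(p : 'I_n) ((\sum_x f x) - f p)); last first.
  by rewrite big_split sumrN /= sum_cst.
apply: eq_bigr => p _; under eq_bigl do rewrite eq_sym.
by rewrite sum_neq1 sum_perm_reindex reinsert_perm_self.
Qed.

(** A card is uniform just after it is chosen, and moves of other cards keep it so by
    [sum_reinserted]. *)
Lemma avg_touched s t (i : 'I_n) (f : 'I_n -> R) :
  avg s t (fun v A => (i \in A)%:R * f (v i)) = (1 - stay ^+ t) / n%:R * \sum_x f x.
Proof.
have n0 : (0 < n)%N by case: (i) => ? /(leq_ltn_trans _) ->.
have n0' : n%:R != 0 :> R by rewrite pnatr_eq0 -lt0n.
elim: t f => [|t IH] f.
  by rewrite /avg /= finset.in_set0 expr0 subrr !mul0r.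
pose g x := (inv_sq R n) * \sum_(a | a != x) \sum_p f (reinsert_perm n a p x).
transitivity (avg s t (fun v A => (i \in A)%:R * g (v i) + (inv_sq R n) * \sum_x f x)).
  rewrite avgS; apply: eq_avg => v A.
  rewrite (step_avg1 i (fun c x => c%:R * f x)) /= mulrDr addrC; congr (_ + _).
    rewrite /g mulrCA; congr (_ * _); rewrite mulr_sumr; apply: eq_bigr => a _.
    by rewrite mulr_sumr.
  by congr (_ * _); apply: eq_bigr => p _; rewrite mul1r.
rewrite avgD IH avg_const // -mulr_sumr sum_reinserted [inv_sq R n * _]mulrA stayE // exprS.
set S := \sum_x _; set q := stay ^+ t.
by rewrite /stay /inv_sq natrX; field.
Qed.

(** In one step an untouched card moves by at most one place, with mean of order 1/n. Its mean
    square displacement grows by at most 3: 1 from the squares and 2 from the drift times a distance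
    below [n]. *)
Lemma avg_untouched_drift s t (i : 'I_n) :
  avg s t (fun v A => (i \notin A)%:R * ((v i)%:R - (s i)%:R) ^+ 2)
    <= 3 * t%:R * stay ^+ t :> R.
Proof.
have n0 : (0 < n)%N by case: (i) => ? /(leq_ltn_trans _) ->.
have n1 : 1 <= n%:R :> R by rewrite ler1n.
have n0' : n%:R != 0 :> R by rewrite pnatr_eq0 -lt0n.
set c : R := (s i)%:R; pose f (x : 'I_n) : R := (x%:R - c) ^+ 2.
have key x : (inv_sq R n) * \sum_(a | a != x) \sum_p f (reinsert_perm n a p x) <= stay * (f x + 3).
  (* The displacement of a card at [x] when the card at [a] goes to [p]: 1 if the moved card crosses
     [x] downwards, -1 if it crosses upwards, 0 otherwise. *)
  pose d (a p : 'I_n) : R := (x < a)%N%:R * (p < x.+1)%N%:R - (a < x)%N%:R * (1 - (p < x)%N%:R).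
  have -> : \sum_(a | a != x) \sum_p f (reinsert_perm n a p x) =
     \sum_(a | a != x) \sum_p (f x + 2 * (x%:R - c) * d a p + d a p ^+ 2).
    apply: eq_bigr => a ax; apply: eq_bigr => p _.
    rewrite /f reinsert_perm_neq // /push /pull /d; set X : R := x%:R.
    have : (a < x)%N || (x < a)%N by move: ax; rewrite -val_eqE /=; lia.
    case: (ltngtP a x) => //= h _.
      case: (ltnP p x) => h'.
        have -> : (x - 1 + (p <= x - 1) = x)%N by lia.
        by rewrite -/X /=; ring.
      have -> : (x - 1 + (p <= x - 1) = x.-1)%N by lia.
      have -> : x.-1%:R = X - 1 by rewrite /X -[in RHS](ltn_predK h) -natr1; ring.
      by rewrite /=; ring.
    rewrite subn0 ltnS natrD -/X; case: (p <= x)%N => /=; ring.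
  have d2 a p : d a p ^+ 2 <= 1.
    rewrite /d; case: (ltngtP x a) => h; case: (p < x.+1)%N; case: (p < x)%N => /=; nra.
  have dsum : \sum_(a | a != x) \sum_p d a p = n%:R - 1 - 2 * x%:R.
    have E a : \sum_p d a p = (1 - (a < x.+1)%N%:R) * x.+1%:R - (a < x)%N%:R * (n%:R - x%:R).
      rewrite /d big_split /= sumrN -!mulr_sumr big_split /= sumrN sum_cst !sum_ltn //; last exact: ltnW.
      rewrite mulr1; congr (_ * _ - _); rewrite ltnS.
      by case: leqP => _ /=; ring.
    rewrite sum_neq1 (eq_bigr _ (fun a _ => E a)) E big_split /= sumrN -!mulr_suml.
    rewrite big_split /= sumrN sum_cst !sum_ltn //; last exact: ltnW.
    by rewrite ltnS leqnn ltnn -natr1 /=; ring.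
  have -> : \sum_(a | a != x) \sum_p (f x + 2 * (x%:R - c) * d a p + d a p ^+ 2)
     = n%:R * (n%:R - 1) * f x + 2 * (x%:R - c) * (n%:R - 1 - 2 * x%:R)
       + \sum_(a | a != x) \sum_p d a p ^+ 2.
    rewrite -dsum mulr_sumr.
    have -> : n%:R * (n%:R - 1) * f x = \sum_(a : 'I_n | a != x) \sum_(p : 'I_n) f x.
      by rewrite sum_neq1 !sum_cst; ring.
    rewrite -!big_split /=; apply: eq_bigr => a _.
    by rewrite mulr_sumr -!big_split.
  have Dle : \sum_(a | a != x) \sum_p d a p ^+ 2 <= n%:R * (n%:R - 1).
    apply: (@le_trans _ _ (\sum_(a : 'I_n | a != x) \sum_(p : 'I_n) 1)).
      by do 2 (apply: ler_sum => ? _); exact: d2.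
    by rewrite sum_neq1 !sum_cst; lra.
  rewrite -stayE // -[leRHS]mulrA; apply: ler_wpM2l; first exact: inv_sq_ge0.
  have xn : (0 <= x%:R :> R) && (x%:R <= n%:R - 1 :> R).
    by rewrite ler0n lerBrDr natr1 ler_nat ltn_ord.
  have cn : 0 <= c <= n%:R - 1.
    by rewrite /c ler0n lerBrDr natr1 ler_nat ltn_ord.
  have : (x%:R - c) * (n%:R - 1 - 2 * x%:R) <= (n%:R - 1) * (n%:R - 1) :> R.
    apply: le_trans (ler_norm _) _; rewrite normrM; apply: ler_pM => //.
      by rewrite ler_norml; apply/andP; split; lra.
    by rewrite ler_norml; apply/andP; split; lra.
  by nra.
suff : avg s t (fun v A => (i \notin A)%:R * f (v i)) <= 3 * t%:R * stay ^+ t by [].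
(* The extra constant [a] closes the induction: splitting off a step replaces it by [3 + a]. *)
have G (a : R) r : avg s r (fun v A => (i \notin A)%:R * (f (v i) + a)) <= (3 * r%:R + a) * stay ^+ r.
  elim: r a => [|r IH] a.
    rewrite /avg /= finset.in_set0 /= /f subrr expr0; lra.
  rewrite avgS.
  apply: (@le_trans _ _ (stay * avg s r (fun v A => (i \notin A)%:R * (f (v i) + (3 + a))))).
    rewrite -avgZ; apply: avg_le => v A.
    rewrite (step_avg1 i (fun c x => (~~ c)%:R * (f x + a))) /= big1 => [|p _]; last by rewrite mul0r.
    rewrite add0r; case: (i \in A) => /=.
      by rewrite big1 ?mulr0 ?mul0r ?mulr0 // => x _; rewrite big1 // => ? _; rewrite mul0r.
    rewrite mul1r; have ky := key (v i).
    have -> : \sum_(a0 | a0 != v i) \sum_p 1 * (f (reinsert_perm n a0 p (v i)) + a) =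
      \sum_(a0 | a0 != v i) \sum_p f (reinsert_perm n a0 p (v i)) + n%:R * (n%:R - 1) * a.
      have -> : n%:R * (n%:R - 1) * a = \sum_(a0 : 'I_n | a0 != v i) \sum_(p : 'I_n) a.
        by rewrite sum_neq1 !sum_cst; ring.
      rewrite -big_split /=; apply: eq_bigr => a0 _; rewrite -big_split /=.
      by apply: eq_bigr => p _; rewrite mul1r.
    rewrite [leLHS]mulrDr [inv_sq R n * (_ * _ * a)]mulrA stayE //; nra.
  rewrite exprS mulrCA; apply: ler_wpM2l; first exact: stay_ge0.
  apply: le_trans (IH _) _; rewrite -natr1 le_eqVlt; apply/orP; left; apply/eqP; ring.
by have := G 0 t; rewrite addr0; apply: le_trans; apply: avg_le => v A; rewrite addr0.
Qed.

End OneCard.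
Arguments stay : clear implicits.

(** * Contraction of tame families by moves of a third card *)

Section Contraction.
Context {R : realType} {n : nat} {I : finType}.
Implicit Types (F : I -> nat -> nat -> R) (K : R).

Definition fdist F x y x' y' : R := \sum_k `|F k x y - F k x' y'|.

(* The sums over [k] are l1 norms of a function of two positions with values in
   families; only its values at distinct positions matter.  An order-preserving
   unit move costs [K] and exchanging adjacent positions costs [2 * K]. *)
Record tame K F : Prop := Tame {
  tame_sup : forall x y, (x < n)%N -> (y < n)%N -> x != y ->
    \sum_k `|F k x y| <= n%:R * K;
  tame_left : forall x y, (x.+1 < n)%N -> (y < n)%N -> x != y -> x.+1 != y ->
    fdist F x y x.+1 y <= K;
  tame_right : forall x y, (x < n)%N -> (y.+1 < n)%N -> x != y -> x != y.+1 ->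
    fdist F x y x y.+1 <= K;
  tame_swap : forall x, (x.+1 < n)%N -> fdist F x x.+1 x.+1 x <= 2 * K;
  tame_sum : \sum_k `|\sum_(x : 'I_n) \sum_(y : 'I_n | x != y) F k x y| <= n%:R ^+ 2 * K
}.

Definition flip F k x y := F k y x.

Lemma fdistC F x y x' y' : fdist F x y x' y' = fdist F x' y' x y.
Proof. by apply: eq_bigr => k _; rewrite distrC. Qed.

Lemma fdist_trans F x' y' x y x'' y'' :
  fdist F x y x'' y'' <= fdist F x y x' y' + fdist F x' y' x'' y''.
Proof. by rewrite -big_split; apply: ler_sum => k _; exact: ler_distD. Qed.

Lemma tame_flip K F : tame K F -> tame K (flip F).
Proof.
case=> S L L' W Z; split=> [x y xn yn xy|x y xn yn xy xy'|x y xn yn xy xy'|x xn|].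
- by apply: S => //; rewrite eq_sym.
- by apply: L' => //; rewrite eq_sym.
- by apply: L => //; rewrite eq_sym.
- by rewrite fdistC; apply: W.
- apply: le_trans Z; apply: ler_sum => k _; rewrite (exchange_big_dep xpredT) //=.
  rewrite le_eqVlt; apply/orP; left; apply/eqP; congr `|_|; apply: eq_bigr => y _.
  by apply: eq_bigl => x; rewrite eq_sym.
Qed.

(** The transition operator of a pair of positions, restricted to choices of a third card; its total
    mass is (n-2)/n. *)
Definition others F k x y : R :=
  inv_sq R n * \sum_(a : 'I_n | ((a : nat) != x) && ((a : nat) != y)) \sum_(p : 'I_n)
    F k (push p (pull a x)) (push p (pull a y)).

Lemma others_flip F k x y : others (flip F) k x y = flip (others F) k x y.
Proof. by congr (_ * _); apply: eq_bigl => a; rewrite andbC. Qed.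

Lemma sum_avoid2 (c : R) x y : (x < n)%N -> (y < n)%N -> x != y ->
  \sum_(a : 'I_n | ((a : nat) != x) && ((a : nat) != y)) c = (n%:R - 2) * c.
Proof.
move=> xn yn xy; have := @sum_neq2 R n (fun=> c) (Ordinal xn) (Ordinal yn).
by rewrite -val_eqE sum_cst => /(_ xy) E; rewrite (eq_bigl _ _ (fun a => erefl)) E; ring.
Qed.

Lemma sum_pred1 (c : R) z : 0 <= c -> \sum_(p : 'I_n) (((p : nat) == z)%:R * c) <= c.
Proof.
move=> c0; case: (ltnP z n) => zn.
  rewrite (bigD1 (Ordinal zn)) //= eqxx mul1r big1 ?addr0 // => p.
  by rewrite -val_eqE /= => /negbTE ->; rewrite mul0r.
rewrite big1 // => p _; have := ltn_ord p; case: eqP => [->|_ _]; last by rewrite mul0r.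
by rewrite ltnNge zn.
Qed.

(** The mass (n-2)/n lies below [stay], and the gap pays for one exceptional insertion place [z a]
    for each [a], since (n-2)(n+1) <= n(n-1). *)
Lemma sum_others_le (c d : R) (x y : nat) (z : 'I_n -> nat) (f : 'I_n -> 'I_n -> R) :
  (x < n)%N -> (y < n)%N -> x != y -> 0 <= d -> d <= c ->
  (forall a p : 'I_n, (a : nat) != x -> (a : nat) != y ->
     f a p <= c + ((p : nat) == z a)%:R * d) ->
  inv_sq R n * (\sum_(a : 'I_n | ((a : nat) != x) && ((a : nat) != y)) \sum_p f a p)
    <= stay R n * c.
Proof.
move=> xn yn xy d0 dc h.
have n0 : (0 < n)%N by case: n xn.
rewrite -stayE // -[leRHS]mulrA; apply: ler_wpM2l; first exact: inv_sq_ge0.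
apply: (@le_trans _ _ ((n%:R - 2) * (n%:R * c + d))).
  rewrite -(sum_avoid2 _ _ _ xn yn xy); apply: ler_sum => a /andP[ax ay].
  apply: (@le_trans _ _ (\sum_(p : 'I_n) (c + ((p : nat) == z a)%:R * d))).
    by apply: ler_sum => p _; exact: h.
  by rewrite big_split /= sum_cst lerD2l; exact: sum_pred1.
have : 2 <= n%:R :> R by rewrite ler_nat; lia.
nra.
Qed.

Lemma sum_norm_others (f : I -> 'I_n -> 'I_n -> R) (P : pred 'I_n) :
  \sum_k `|inv_sq R n * \sum_(a | P a) \sum_p f k a p|
   <= inv_sq R n * \sum_(a | P a) \sum_p \sum_k `|f k a p|.
Proof.
apply: (@le_trans _ _ (\sum_k inv_sq R n * \sum_(a | P a) \sum_p `|f k a p|)).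
  apply: ler_sum => k _; rewrite normrM (ger0_norm inv_sq_ge0).
  apply: ler_wpM2l; first exact: inv_sq_ge0.
  apply: le_trans (ler_norm_sum _ _ _) _; apply: ler_sum => a _.
  exact: ler_norm_sum.
rewrite -mulr_sumr exchange_big /= le_eqVlt; apply/orP; left; apply/eqP; congr (_ * _).
by apply: eq_bigr => a _; rewrite exchange_big.
Qed.

Lemma tame_ge0 K F : (1 < n)%N -> tame K F -> 0 <= K.
Proof.
move=> n1 /tame_sup/(_ 0%N 1%N (ltnW n1) n1 erefl) h.
have : 0 <= n%:R * K by apply: le_trans h; exact: sumr_ge0.
by rewrite pmulr_rge0 // ltr0n ltnW.
Qed.

(* Couple the two chains by moving the same card to the same place, except that
   choosing the card at [y.+1] in the first is paired with choosing the card at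
   [y] in the second; the latter choice makes the two configurations coincide. *)
Lemma tame_others_right K F x y : tame K F ->
  (x < n)%N -> (y.+1 < n)%N -> x != y -> x != y.+1 ->
  fdist (others F) x y x y.+1 <= stay R n * K.
Proof.
move=> gF xn yn xy xy'; have K0 : 0 <= K by apply: tame_ge0 gF; lia.
have yn' := ltnW yn.
have E k : others F k x y - others F k x y.+1 =
   inv_sq R n * \sum_(a : 'I_n | [&& (a : nat) != x, (a : nat) != y & (a : nat) != y.+1])
     \sum_(p : 'I_n) (F k (push p (pull a x)) (push p (pull a y))
         - F k (push p (pull a x)) (push p (pull a y.+1))).
  rewrite /others -mulrBr; congr (_ * _).
  rewrite [X in X - _](bigD1 (Ordinal yn)) /=; last by lia.
  rewrite [X in _ - X](bigD1 (Ordinal yn')) /=; last by lia.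
  have -> : \sum_(p < n) F k (push p (pull y.+1 x)) (push p (pull y.+1 y)) =
            \sum_(p < n) F k (push p (pull y x)) (push p (pull y y.+1)).
    apply: eq_bigr => p _; congr (F k (push p _) (push p _)); rewrite /pull; lia.
  rewrite opprD addrACA subrr add0r -sumrN.
  under eq_bigl => a do rewrite -val_eqE /= -andbA.
  under [X in _ + X]eq_bigl => a do rewrite -val_eqE /= -andbA [(_ != y.+1) && _]andbC.
  rewrite -big_split /=; apply: eq_bigr => a _.
  by rewrite -sumrN -big_split.
rewrite /fdist; under eq_bigr do rewrite E.
apply: le_trans (sum_norm_others _ _) _.
apply: (@le_trans _ _ (inv_sq R n * (\sum_(a : 'I_n | ((a : nat) != x) && ((a : nat) != y))
    \sum_(p : 'I_n) if (a : nat) == y.+1 then 0 else fdist F (push p (pull a x)) (push p (pull a y))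
       (push p (pull a x)) (push p (pull a y.+1))))).
  apply: ler_wpM2l; first exact: inv_sq_ge0.
  rewrite big_mkcond [leRHS]big_mkcond /=; apply: ler_sum => a _.
  case: (_ != x); case: (_ != y) => //=; case: eqP => //= _.
  by rewrite big1.
apply: (sum_others_le _ K _ _ (fun a => (pull a y).+1)) => // a p ax ay.
case: eqP => [_|ay']; first by rewrite addr_ge0 // mulr_ge0.
have an := ltn_ord a; have pn := ltn_ord p.
(* Insertion exactly between the two neighbouring places moves them two apart. The place in between
   is that of the inserted card, so two unit moves join them without meeting the first card. *)
case: eqP => [pe|pne].
  rewrite mul1r; apply: le_trans (fdist_trans F (push p (pull a x)) (push p (pull a y)).+1 _ _ _ _) _.
  have -> : push p (pull a y.+1) = (push p (pull a y)).+2 by rewrite /push /pull in pe *; lia.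
  by apply: lerD; apply: (tame_right _ _ gF); rewrite /push /pull in pe *; lia.
rewrite mul0r addr0.
have -> : push p (pull a y.+1) = (push p (pull a y)).+1 by rewrite /push /pull in pne *; lia.
by apply: (tame_right _ _ gF); rewrite /push /pull in pne *; lia.
Qed.

(** The same choices are allowed in both configurations, so none has to be re-paired. An exchange of
    neighbours remains one unless a card is inserted between them. *)
Lemma tame_others_swap K F x : tame K F -> (x.+1 < n)%N ->
  fdist (others F) x x.+1 x.+1 x <= 2 * (stay R n * K).
Proof.
move=> gF xn; have K0 : 0 <= K by apply: tame_ge0 gF; lia.
have xn' := ltnW xn.
have E k : others F k x x.+1 - others F k x.+1 x =
   inv_sq R n * \sum_(a : 'I_n | ((a : nat) != x) && ((a : nat) != x.+1))
     \sum_(p : 'I_n) (F k (push p (pull a x)) (push p (pull a x.+1))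
         - F k (push p (pull a x.+1)) (push p (pull a x))).
  rewrite /others -mulrBr; congr (_ * _).
  under [X in _ - X]eq_bigl => a do rewrite andbC.
  rewrite -sumrN -big_split /=; apply: eq_bigr => a _.
  by rewrite -sumrN -big_split.
rewrite /fdist; under eq_bigr do rewrite E.
apply: le_trans (sum_norm_others _ _) _.
rewrite mulrCA.
apply: (sum_others_le _ (2 * K) _ _ (fun a => (pull a x).+1)) => //; first by lia.
  by rewrite mulr_ge0.
move=> a p ax ay; have an := ltn_ord a; have pn := ltn_ord p.
set X := push p (pull a x); rewrite -[leLHS]/(fdist F X (push p (pull a x.+1)) (push p (pull a x.+1)) X).
(* An exchange at distance two costs K + 2K + K: bring the cards together, exchange them, move them
   apart. *)
case: eqP => [pe|pne].
  have -> : push p (pull a x.+1) = X.+2 by rewrite /X /push /pull in pe *; lia.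
  apply: le_trans (fdist_trans F X X.+1 _ _ _ _) _.
  rewrite mul1r.
  have -> : 2 * K + 2 * K = K + (2 * K + K) by ring.
  apply: lerD.
    by rewrite fdistC; apply: (tame_right _ _ gF); rewrite /X /push /pull in pe *; lia.
  apply: le_trans (fdist_trans F X.+1 X _ _ _ _) _.
  apply: lerD; first by apply: (tame_swap _ _ gF); rewrite /X /push /pull in pe *; lia.
  by apply: (tame_left _ _ gF); rewrite /X /push /pull in pe *; lia.
rewrite mul0r addr0.
have -> : push p (pull a x.+1) = X.+1 by rewrite /X /push /pull in pne *; lia.
by apply: (tame_swap _ _ gF); rewrite /X /push /pull in pne *; lia.
Qed.

(** For fixed [a] and [p], reinsertion maps pairs avoiding [a] bijectively onto pairs avoiding [p];
    a given pair avoids n-2 values of [p], and [a] is free. *)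
Lemma sum_others (f : nat -> nat -> R) :
  \sum_(x : 'I_n) \sum_(y : 'I_n | x != y)
     \sum_(a : 'I_n | ((a : nat) != x) && ((a : nat) != y)) \sum_(p : 'I_n)
       f (push p (pull a x)) (push p (pull a y)) =
  n%:R * (n%:R - 2) * \sum_(x : 'I_n) \sum_(y : 'I_n | x != y) f x y.
Proof.

pose G (x y a p : 'I_n) := [&& x != y, a != x & a != y]%:R
                           * f (push p (pull a x)) (push p (pull a y)).
transitivity (\sum_(a : 'I_n) \sum_(p : 'I_n) \sum_(x : 'I_n) \sum_(y : 'I_n) G x y a p).
  transitivity (\sum_(x : 'I_n) \sum_(y : 'I_n) \sum_(a : 'I_n) \sum_(p : 'I_n) G x y a p).
    apply: eq_bigr => x _; rewrite big_mkcond; apply: eq_bigr => y _.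
    rewrite /G; case: (x != y) => /=; last first.
      by rewrite big1 // => a _; rewrite big1 // => p _; rewrite mul0r.
    rewrite big_mkcond; apply: eq_bigr => a _; rewrite -!val_eqE /=.
    case: (_ && _); first by apply: eq_bigr => p _; rewrite mul1r.
    by rewrite big1 // => p _; rewrite mul0r.
  under eq_bigr => x _ do rewrite exchange_big.
  rewrite exchange_big; apply: eq_bigr => a _.
  under eq_bigr => x _ do rewrite exchange_big.
  by rewrite exchange_big.
transitivity (\sum_(a : 'I_n) \sum_(p : 'I_n) \sum_(x : 'I_n) \sum_(y : 'I_n)
   ([&& x != y, p != x & p != y]%:R * f x y)).
  apply: eq_bigr => a _; apply: eq_bigr => p _.
  rewrite [RHS](reindex_inj (@perm_inj _ (reinsert_perm n a p))); apply: eq_bigr => x _.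
  rewrite [RHS](reindex_inj (@perm_inj _ (reinsert_perm n a p))); apply: eq_bigr => y _.
  have pE z : (p != reinsert_perm n a p z) = (a != z).
    by rewrite -{1}(reinsert_perm_self n a p) (inj_eq perm_inj).
  rewrite /G !pE (inj_eq perm_inj).
  case: (eqVneq a x) => [_|ax] /=; first by rewrite andbF !mul0r.
  case: (eqVneq a y) => [_|ay] /=; first by rewrite andbF !mul0r.
  by rewrite !reinsert_perm_neq.
rewrite sum_cst -mulrA; congr (_ * _).
rewrite exchange_big mulr_sumr; apply: eq_bigr => x _.
rewrite exchange_big mulr_sumr [RHS]big_mkcond /=; apply: eq_bigr => y _.
case: eqVneq => [_|xy] /=; first by rewrite big1 // => p _; rewrite mul0r.
rewrite -mulr_suml; congr (_ * _).
have := @sum_neq2 R n (fun=> 1) x y xy; rewrite sum_cst mulr1 => E.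
transitivity (n%:R - 1 - 1 : R); last by ring.
by rewrite -E [RHS]big_mkcond; apply: eq_bigr => p _; case: (_ && _).
Qed.

(** The gained factor [stay] makes the errors of successive steps summable in [touched_pairs]. Left
    moves reduce to right moves by [flip]. *)
Lemma tame_others K F : (2 < n)%N -> tame K F -> tame (stay R n * K) (others F).
Proof.
move=> n2 gF; have K0 : 0 <= K by apply: tame_ge0 gF; lia.
split=> [x y xn yn xy|x y xn yn xy xy'|x y xn yn xy xy'|x xn|].
- apply: le_trans (sum_norm_others _ _) _.
  rewrite mulrCA; apply: (sum_others_le _ 0 _ _ (fun=> 0%N)) => //; first by rewrite mulr_ge0.
  move=> a p ax ay; rewrite mulr0 addr0; apply: (tame_sup _ _ gF).
  + have := ltn_ord a; have := ltn_ord p; rewrite /push /pull; lia.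
  + have := ltn_ord a; have := ltn_ord p; rewrite /push /pull; lia.
  + rewrite /push /pull; lia.
- have := tame_others_right _ _ y x (tame_flip _ _ gF) yn xn.
  rewrite eq_sym xy eq_sym xy' => /(_ isT isT); apply: le_trans.
  by rewrite /fdist; under [leRHS]eq_bigr => k _ do rewrite !others_flip.
- exact: tame_others_right.
- exact: tame_others_swap.
- under eq_bigr => k _.
    under eq_bigr => x _ do rewrite -mulr_sumr.
    rewrite -mulr_sumr sum_others normrM normrM; over.
  rewrite -mulr_sumr.
  have n0 : n%:R != 0 :> R by rewrite pnatr_eq0; lia.
  have n3 : 3 <= n%:R :> R by rewrite ler_nat.
  apply: (@le_trans _ _ (`|inv_sq R n| * (`|n%:R * (n%:R - 2)| * (n%:R ^+ 2 * K)))).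
    apply: ler_wpM2l => //; rewrite -mulr_sumr; apply: ler_wpM2l => //.
    exact: (tame_sum _ _ gF).
  rewrite (ger0_norm inv_sq_ge0) ger0_norm; last by nra.
  rewrite /inv_sq natrX /stay.
  have -> : (n%:R ^+ 2)^-1 * (n%:R * (n%:R - 2) * (n%:R ^+ 2 * K)) = (n%:R * (n%:R - 2)) * K.
    by field.
  have -> : n%:R ^+ 2 * ((1 - n%:R^-1) * K) = (n%:R * (n%:R - 1)) * K by field.
  apply: ler_wpM2r => //; nra.
Qed.

End Contraction.

Arguments tame {R} n {I}.
Arguments others {R} n {I}.

(** * Covariances of pairs of touched cards *)

Section TwoCards.
Context {R : realType} {n : nat}.
Hypothesis n2 : (2 < n)%N.
Implicit Types (F : 'I_n * 'I_n -> nat -> nat -> R) (K : R).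

Let n0 : (0 < n)%N. Proof. lia. Qed.
Let n0' : n%:R != 0 :> R. Proof. by rewrite pnatr_eq0; lia. Qed.
Let n3 : 3 <= n%:R :> R. Proof. by rewrite ler_nat. Qed.

Lemma sum_push (p : 'I_n) (f : nat -> R) :
  \sum_(y : 'I_n) (if (y.+1 < n)%N then f (push p y) else 0) = \sum_(z : 'I_n | p != z) f z.
Proof.
have ln : (n.-1 < n)%N by lia.
(* Removing the last place shifts no other one, so [reinsert_perm n a p] acts as [push p] on the
   ranks below n-1. *)
pose a : 'I_n := Ordinal ln.
transitivity (\sum_(y | y != a) f (reinsert_perm n a p y)).
  rewrite [RHS]big_mkcond; apply: eq_bigr => y _.
  have := ltn_ord y; case: (eqVneq y a) => [->|ya] yn.
    by rewrite /= prednK ?ltnn.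
  rewrite reinsert_perm_neq 1?eq_sym // /pull /=; move: ya; rewrite -val_eqE /= => ya.
  have -> : (y.+1 < n)%N by lia.
  by congr (f (push p _)); lia.
rewrite sum_neq1 (sum_perm_reindex (fun x => f x)) reinsert_perm_self -sum_neq1.
by apply: eq_bigl => z; rewrite eq_sym.
Qed.

(** The second card cannot pass the first by unit moves; the path exchanges the two cards and then
    takes two unit moves down. *)
Lemma tame_jump K F z : tame n K F -> (z.+2 < n)%N -> fdist F z.+1 z.+2 z.+1 z <= 4 * K.
Proof.
move=> gF zn.
apply: le_trans (fdist_trans F z.+2 z.+1 _ _ _ _) _.
have -> : 4 * K = 2 * K + (K + K) by ring.
apply: lerD; first exact: (tame_swap _ _ gF).
apply: le_trans (fdist_trans F z.+2 z _ _ _ _) _.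
by apply: lerD; rewrite fdistC; [apply: (tame_right _ _ gF)|apply: (tame_left _ _ gF)]; lia.
Qed.

(* The sum over [p] puts the first card at a uniform place, the second having
   rank [r < n.-1] among the other cards; [0] is a padding value at [r = n.-1]. *)
Definition inserted F k r : R :=
  if (r.+1 < n)%N then inv_sq R n * \sum_(p : 'I_n) F k p (push p r) else 0.

(** By [sum_push], the place of the first card and the rank of the second enumerate all pairs of
    distinct places, so [tame_sum] applies. *)
Lemma inserted_sum K F : tame n K F -> \sum_k `|\sum_(y : 'I_n) inserted F k y| <= K.
Proof.
move=> gF.
have E k : \sum_(y : 'I_n) inserted F k y =
    inv_sq R n * \sum_(x : 'I_n) \sum_(y : 'I_n | x != y) F k x y.
  transitivity (inv_sq R n * \sum_(y : 'I_n) \sum_(p : 'I_n)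
      if (y.+1 < n)%N then F k p (push p y) else 0).
    rewrite mulr_sumr; apply: eq_bigr => y _; rewrite /inserted.
    by case: ifP => // _; rewrite big1 ?mulr0.
  by rewrite exchange_big; congr (_ * _); apply: eq_bigr => p _; exact: (sum_push p (F k p)).
under eq_bigr do rewrite E normrM (ger0_norm inv_sq_ge0).
rewrite -mulr_sumr; apply: le_trans (ler_wpM2l inv_sq_ge0 (tame_sum _ _ gF)) _.
by rewrite /inv_sq natrX mulrA mulVf ?mul1r // expf_neq0.
Qed.

(** Raising the rank costs K for each [p], but 4K for p = y, where the second card jumps over the
    first. Averaging gives (n+3)K/n^2 per rank, at most 2K in total; the drop to the padding value
    costs another K. *)
Lemma inserted_var K F : tame n K F ->
  \sum_(y : 'I_n) \sum_k `|inserted F k y - inserted F k y.-1| <= 3 * K.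
Proof.
move=> gF; have K0 : 0 <= K by apply: tame_ge0 gF; lia.
have bnd (f : 'I_n * 'I_n -> 'I_n -> R) :
    \sum_k `|inv_sq R n * \sum_p f k p| <= inv_sq R n * \sum_p \sum_k `|f k p|.
  rewrite exchange_big mulr_sumr; apply: ler_sum => k _.
  rewrite normrM (ger0_norm inv_sq_ge0); apply: ler_wpM2l; first exact: inv_sq_ge0.
  exact: ler_norm_sum.
apply: (@le_trans _ _ (\sum_(y : 'I_n) (((y : nat) == n.-1)%:R * K + inv_sq R n * ((n%:R + 3) * K)))).
  apply: ler_sum => -[y /= yn] _.
  have [y0|y0] := posnP y.
    rewrite y0 big1 => [|k _]; last by rewrite subrr normr0.
    by rewrite addr_ge0 // mulr_ge0 ?inv_sq_ge0 ?mulr_ge0 ?ler0n // addr_ge0.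
  have [yl|yl] := eqVneq y n.-1.
    rewrite mul1r -[leLHS]addr0; apply: lerD; last first.
      by rewrite mulr_ge0 ?inv_sq_ge0 ?mulr_ge0 // addr_ge0.
    have -> : \sum_k `|inserted F k y - inserted F k y.-1| =
        \sum_k `|inv_sq R n * \sum_(p : 'I_n) F k p (push p y.-1)|.
      apply: eq_bigr => k _; rewrite /inserted.
      have -> : (y.+1 < n)%N = false by lia.
      have -> : (y.-1.+1 < n)%N by lia.
      by rewrite sub0r normrN.
    apply: le_trans (bnd _) _.
    apply: (@le_trans _ _ (inv_sq R n * \sum_(p : 'I_n) n%:R * K)).
      apply: ler_wpM2l; first exact: inv_sq_ge0.
      apply: ler_sum => p _; have pn := ltn_ord p.
      by apply: (tame_sup _ _ gF) => //; rewrite /push; lia.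
    rewrite sum_cst /inv_sq natrX.
    by have -> : (n%:R ^+ 2)^-1 * (n%:R * (n%:R * K)) = K by field.
  rewrite mul0r add0r.
  have -> : \sum_k `|inserted F k y - inserted F k y.-1| =
      \sum_k `|inv_sq R n * \sum_(p : 'I_n) (F k p (push p y) - F k p (push p y.-1))|.
    apply: eq_bigr => k _; rewrite /inserted.
    have -> : (y.+1 < n)%N by lia.
    have -> : (y.-1.+1 < n)%N by lia.
    by rewrite -mulrBr big_split sumrN.
  apply: le_trans (bnd _) _; apply: ler_wpM2l; first exact: inv_sq_ge0.
  apply: (@le_trans _ _ (\sum_(p : 'I_n) (K + ((p : nat) == y)%:R * (3 * K)))); last first.
    rewrite big_split /= sum_cst [leRHS]mulrDl lerD2l; apply: sum_pred1; nra.
  apply: ler_sum => p _; have pn := ltn_ord p.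
  rewrite -[leLHS]/(fdist F p (push p y) p (push p y.-1)).
  case: eqP => [pe|pne].
    have -> : push p y = y.-1.+2 by rewrite /push pe leqnn; lia.
    have -> : push p y.-1 = y.-1 by rewrite /push; lia.
    have -> : (p : nat) = y.-1.+1 by lia.
    apply: le_trans (tame_jump _ _ _ gF _) _; last by rewrite mul1r; lra.
    by lia.
  rewrite mul0r addr0 fdistC.
  have -> : push p y = (push p y.-1).+1 by rewrite /push; lia.
  by apply: (tame_right _ _ gF); rewrite /push; lia.
rewrite big_split /= sum_cst.
have -> : 3 * K = K + 2 * K by ring.
apply: lerD; first exact: sum_pred1.
have -> : n%:R * (inv_sq R n * ((n%:R + 3) * K)) = (n%:R + 3) / n%:R * K.
  by rewrite /inv_sq natrX; field.
have n3' := n3; apply: ler_wpM2r => //; rewrite ler_pdivrMr; lra.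
Qed.

(* Write b(pull x y) = b(y) - [x < y] (b(y) - b(y-1)) with b = [inserted F k]:
   since the touched card [k.2] is uniformly distributed, the first term is
   controlled by the sum of b and the second one by its total variation. *)
Lemma inserted_bound K F s t : tame n K F ->
  \sum_k `|avg s t (fun v A => (k.2 \in A)%:R * inserted F k (pull (v k.1) (v k.2)))|
    <= 4 * K / n%:R.
Proof.
move=> gF.
have m1 : 0 <= 1 - stay R n ^+ t <= 1.
  have h0 := @stay_ge0 R n; have h1 := @stay_le1 R n.
  by rewrite subr_ge0 exprn_ile1 // gerBl exprn_ge0.
pose g k y : R := `|inserted F k y - inserted F k y.-1|.
apply: (@le_trans _ _ (\sum_k (`|\sum_(y : 'I_n) inserted F k y| / n%:R
      + (\sum_(y : 'I_n) g k y) / n%:R))).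
  apply: ler_sum => -[i j] _ /=.
  pose H (v : {perm 'I_n}) (A : {set 'I_n}) : R := (j \in A)%:R * inserted F (i, j) (v j).
  pose H' (v : {perm 'I_n}) (A : {set 'I_n}) : R := (j \in A)%:R *
     ((v i < v j)%N%:R * (inserted F (i, j) (v j) - inserted F (i, j) (v j).-1)).
  have -> : avg s t (fun v A => (j \in A)%:R * inserted F (i, j) (pull (v i) (v j)))
     = avg s t H + (-1) * avg s t H'.
    rewrite -avgZ -avgD; apply: eq_avg => v A; rewrite /H /H' /pull.
    by case: (v i < v j)%N; rewrite /= ?subn1 ?subn0; ring.
  have bd (S : R) : 0 <= S -> (1 - stay R n ^+ t) / n%:R * S <= S / n%:R.
    move=> S0; rewrite mulrAC ler_pM2r ?invr_gt0 ?ltr0n //.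
    by case/andP: m1 => a b; rewrite ler_piMl.
  apply: le_trans (ler_normD _ _) _; apply: lerD.
    rewrite (avg_touched s t j (fun x => inserted F (i, j) x)) normrM ger0_norm; first exact: bd.
    by case/andP: m1 => a _; rewrite divr_ge0.
  rewrite mulN1r normrN.
  apply: le_trans (ler_norm_avg _ _ _) _.
  apply: (@le_trans _ _ (avg s t (fun v A => (j \in A)%:R * g (i, j) (v j)))).
    apply: avg_le => v A; rewrite /H' /g !normrM !normr_nat ler_wpM2l //.
    by rewrite ler_piMl // lern1; case: (_ < _)%N.
  rewrite (avg_touched s t j (fun x => g (i, j) x)); apply: bd.
  by apply: sumr_ge0 => y _; exact: normr_ge0.
rewrite big_split /= -!mulr_suml -mulrDl ler_pM2r ?invr_gt0 ?ltr0n //.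
have -> : 4 * K = K + 3 * K by ring.
apply: lerD; first exact: inserted_sum.
by rewrite exchange_big; exact: inserted_var.
Qed.

Lemma sum_sub_norm (I : finType) (P : pred I) (f : I -> R) :
  `|\sum_(k | P k) f k| <= \sum_k `|f k|.
Proof.
apply: le_trans (ler_norm_sum _ _ _) _.
by rewrite big_mkcond; apply: ler_sum => k _; case: (P k).
Qed.

(** Renaming the two cards together with their positions lets a choice of the second card be treated
    as one of the first. *)
Lemma tame_flip_index K F : tame n K F ->
  tame n K (fun k x y => F (k.2, k.1) y x).
Proof.
have rb (f : 'I_n * 'I_n -> R) : \sum_k f (k.2, k.1) = \sum_k f k.
  by rewrite [RHS](reindex_inj (h := fun k => (k.2, k.1))) // => -[a b] [c d] /= [-> ->].
move/tame_flip; case=> S L L' W Z.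
split=> [x y xn yn xy|x y xn yn xy xy'|x y xn yn xy xy'|x xn|].
- by rewrite (rb (fun k => `|flip F k x y|)); exact: S.
- by rewrite /fdist (rb (fun k => `|flip F k x y - flip F k x.+1 y|)); exact: L.
- by rewrite /fdist (rb (fun k => `|flip F k x y - flip F k x y.+1|)); exact: L'.
- by rewrite /fdist (rb (fun k => `|flip F k x x.+1 - flip F k x.+1 x|)); exact: W.
- by rewrite (rb (fun k => `|\sum_(x : 'I_n) \sum_(y : 'I_n | x != y) flip F k x y|)).
Qed.

(** A last choice of a third card leads to the induction hypothesis with [stay R n * K]; a last
    choice of either card of the pair costs 4K/n by [inserted_bound]. The errors add up because stay
    (1 - q) + 1/n = 1 - stay q. *)
Lemma touched_pairs K F s t : tame n K F ->
  `|\sum_(k | k.1 != k.2) avg s t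
      (fun v A => (k.1 \in A)%:R * (k.2 \in A)%:R * F k (v k.1) (v k.2))|
   <= 8 * K * (1 - stay R n ^+ t).
Proof.
elim: t K F => [|t IH] K F gF.
  rewrite big1 ?normr0 ?expr0 ?subrr ?mulr0 // => k _.
  by rewrite /avg /= finset.in_set0 !mul0r.
pose F' k x y := F (k.2, k.1) y x.
(* The three sums belong to a last choice of a third card, of [k.1] and of [k.2]. *)
have E : \sum_(k | k.1 != k.2) avg s t.+1
      (fun v A => (k.1 \in A)%:R * (k.2 \in A)%:R * F k (v k.1) (v k.2)) =
   \sum_(k | k.1 != k.2) avg s t (fun v A =>
        (k.1 \in A)%:R * (k.2 \in A)%:R * others n F k (v k.1) (v k.2))
   + (\sum_(k | k.1 != k.2) avg s t
        (fun v A => (k.2 \in A)%:R * inserted F k (pull (v k.1) (v k.2)))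
   + \sum_(k | k.1 != k.2) avg s t
        (fun v A => (k.2 \in A)%:R * inserted F' k (pull (v k.1) (v k.2)))).
  have -> : \sum_(k | k.1 != k.2) avg s t
        (fun v A => (k.2 \in A)%:R * inserted F' k (pull (v k.1) (v k.2)))
     = \sum_(k | k.1 != k.2) avg s t
        (fun v A => (k.1 \in A)%:R * inserted F' (k.2, k.1) (pull (v k.2) (v k.1))).
    rewrite (reindex_inj (h := fun k => (k.2, k.1))) /=; last by move=> [a b] [c d] /= [-> ->].
    by apply: eq_bigl => k; rewrite eq_sym.
  rewrite -!big_split /=; apply: eq_bigr => -[i j] /= ij.
  rewrite avgS -!avgD; apply: eq_avg => v A.
  rewrite (step_avg2 i j (fun c d x y => c%:R * d%:R * F (i, j) x y)) //=.
  have vij : (v i : nat) != v j by rewrite val_eqE (inj_eq perm_inj).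
  have vi := ltn_ord (v i); have vj := ltn_ord (v j).
  rewrite [LHS]mulrDr [LHS]addrC; congr (_ + _).
    rewrite /others [RHS]mulrCA; congr (_ * _); rewrite mulr_sumr.
    apply: eq_big => [a|a /andP[ai aj]]; first by rewrite -!val_eqE.
    by rewrite mulr_sumr; apply: eq_bigr => p _; rewrite !reinsert_perm_neq.
  rewrite [LHS]mulrDr /inserted /F' /=.
  have -> : ((pull (v i) (v j)).+1 < n)%N by rewrite /pull; lia.
  have -> : ((pull (v j) (v i)).+1 < n)%N by rewrite /pull; lia.
  congr (_ + _); rewrite [RHS]mulrCA; congr (_ * _); rewrite mulr_sumr;
    apply: eq_bigr => p _; rewrite reinsert_perm_neq ?mul1r ?mulr1 //.
  by rewrite eq_sym.
rewrite E; apply: le_trans (ler_normD _ _) _.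
apply: (@le_trans _ _ (8 * (stay R n * K) * (1 - stay R n ^+ t) + (4 * K / n%:R + 4 * K / n%:R))).
  apply: lerD; first exact: (IH _ _ (tame_others _ _ n2 gF)).
  apply: le_trans (ler_normD _ _) _.
  apply: lerD; apply: le_trans (sum_sub_norm _ _ _) _; apply: inserted_bound => //.
  exact: tame_flip_index.
rewrite le_eqVlt; apply/orP; left; apply/eqP; rewrite exprS /stay.
set q := (_ ^+ t); by field.
Qed.

End TwoCards.

Definition untouched_count (R : realType) (n t : nat) : R := n%:R * stay R n ^+ t.

(** * Moments of the centred count of cards near their start *)

Section Statistic.
Context {R : realType} {n : nat} (w : nat).
Hypotheses (n2 : (2 < n)%N) (w0 : (0 < w)%N) (wn : (w <= n)%N).
Implicit Types (s v : {perm 'I_n}) (A : {set 'I_n}).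

Let n0' : n%:R != 0 :> R. Proof. by rewrite pnatr_eq0; lia. Qed.
Let n3 : 3 <= n%:R :> R. Proof. by rewrite ler_nat. Qed.
Let w1 : 1 <= w%:R :> R. Proof. by rewrite ler1n. Qed.
Let wnR : w%:R <= n%:R :> R. Proof. by rewrite ler_nat. Qed.

Definition close_to (i x : nat) : bool := (x <= i + w)%N && (i <= x + w)%N.

Definition close_freq (i : nat) : R := (\sum_(x : 'I_n) (close_to i x)%:R) / n%:R.

Definition bump (i x : nat) : R := (close_to i x)%:R - close_freq i.

Lemma close_toC i x : close_to i x = close_to x i.
Proof. by rewrite /close_to andbC. Qed.

(** The window is a difference of two initial segments with at most 2w + 1 <= 3w places. *)
Lemma sum_close_to i : \sum_(x : 'I_n) (close_to i x)%:R <= 3 * w%:R :> R.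
Proof.
have E (x : 'I_n) : (close_to i x)%:R =
    (x < minn n (i + w).+1)%N%:R - (x < minn n (i - w))%N%:R :> R.
  have xn := ltn_ord x; rewrite !leq_min xn /= /close_to.
  case: (leqP x (i + w)) => h1; case: (leqP i (x + w)) => h2.
  - have -> : (x < (i + w).+1)%N by lia.
    by have -> : (x < i - w)%N = false by [lia]; rewrite subr0.
  - have -> : (x < (i + w).+1)%N by lia.
    by have -> : (x < i - w)%N by [lia]; rewrite subrr.
  - have -> : (x < (i + w).+1)%N = false by lia.
    by have -> : (x < i - w)%N = false by [lia]; rewrite subr0.
  - lia.
under eq_bigr do rewrite E.
rewrite big_split sumrN /= !sum_ltn ?geq_minl // lerBlDr -natrM -natrD ler_nat; lia.
Qed.

Lemma close_freq_ge0 i : 0 <= close_freq i.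
Proof. by rewrite divr_ge0 // sumr_ge0. Qed.

Lemma close_freq_le i : close_freq i <= 3 * w%:R / n%:R.
Proof. by rewrite /close_freq ler_pM2r ?sum_close_to // invr_gt0 ltr0n; lia. Qed.

Lemma close_freq_le1 i : close_freq i <= 1.
Proof.
rewrite /close_freq ler_pdivrMr; last by rewrite ltr0n; lia.
by rewrite mulrC -sum_cst; apply: ler_sum => x _; rewrite lern1; case: close_to.
Qed.

Lemma bump_sum i : \sum_(x : 'I_n) bump i x = 0.
Proof. by rewrite big_split sumrN /= sum_cst mulrC divfK ?subrr. Qed.

Lemma bump_sqr_le1 i x : bump i x ^+ 2 <= 1.
Proof.
rewrite /bump; have := close_freq_ge0 i; have := close_freq_le1 i.
by case: (close_to i x) => /=; nra.
Qed.

Lemma bump_sqr_sum i : \sum_(x : 'I_n) bump i x ^+ 2 <= 3 * w%:R.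
Proof.
apply: le_trans (sum_close_to i).
have E (x : 'I_n) : bump i x ^+ 2 = (close_to i x)%:R - close_freq i * (bump i x + (close_to i x)%:R).
  by rewrite /bump; case: (close_to i x) => /=; ring.
under eq_bigr do rewrite E.
rewrite big_split sumrN /= -mulr_sumr big_split /= bump_sum add0r gerBl.
by rewrite mulr_ge0 ?close_freq_ge0 ?sumr_ge0.
Qed.

Lemma bump_norm_sum x : \sum_(i : 'I_n) `|bump i x| <= 6 * w%:R.
Proof.
apply: (@le_trans _ _ (\sum_(i : 'I_n) ((close_to x i)%:R + 3 * w%:R / n%:R))).
  apply: ler_sum => i _; rewrite close_toC; apply: le_trans (ler_normB _ _) _.
  apply: lerD; first by rewrite ger0_norm.
  by rewrite ger0_norm ?close_freq_le ?close_freq_ge0.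
rewrite big_split /= sum_cst.
have -> : n%:R * (3 * w%:R / n%:R) = 3 * w%:R :> R by field.
have := sum_close_to x; lra.
Qed.

(** A unit move of the position changes membership only for the windows centred at x + 1 + w and x -
    w. *)
Lemma bump_diff_sum x : \sum_(i : 'I_n) `|bump i x - bump i x.+1| <= 2.
Proof.
apply: (@le_trans _ _ (\sum_(i : 'I_n) (((i : nat) == x.+1 + w)%N%:R * 1
    + ((i : nat) == x - w)%N%:R * 1))).
  apply: ler_sum => i _; rewrite /bump opprB addrA subrK /close_to.
  have [h|h] := leqP x (i + w); have [h'|h'] := leqP i (x + w);
  have [k|k] := leqP x.+1 (i + w); have [k'|k'] := leqP i (x.+1 + w) => /=;
  rewrite ?subrr ?subr0 ?sub0r ?normrN ?normr0 ?normr1 ?mulr1 ?addr_ge0 //.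
  all: try lia.
  all: try (have -> : (i : nat) == (x.+1 + w)%N by [lia]; rewrite lerDl //).
  all: try (have -> : (i : nat) == (x - w)%N by [lia]; rewrite lerDr //).
rewrite big_split /=; have := @sum_pred1 R n 1 (x.+1 + w)%N ler01.
have := @sum_pred1 R n 1 (x - w)%N ler01; lra.
Qed.

Definition bump2 (k : 'I_n * 'I_n) (x y : nat) : R := bump k.1 x * bump k.2 y.

Lemma sum_norm2 (f g : 'I_n -> R) :
  \sum_(k : 'I_n * 'I_n) `|f k.1 * g k.2| = (\sum_i `|f i|) * (\sum_j `|g j|).
Proof.
rewrite big_distrlr /= pair_big /=; apply: eq_bigr => k _; exact: normrM.
Qed.

Lemma bump2_norm_sum x y : \sum_k `|bump2 k x y| <= 36 * w%:R * w%:R.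
Proof.
rewrite (sum_norm2 (fun i => bump i x) (fun j => bump j y)).
have -> : 36 * w%:R * w%:R = (6 * w%:R) * (6 * w%:R) :> R by ring.
by apply: ler_pM; rewrite ?sumr_ge0 ?bump_norm_sum.
Qed.

Lemma bump2_left x y : fdist bump2 x y x.+1 y <= 12 * w%:R.
Proof.
rewrite /fdist /bump2; under eq_bigr do rewrite -mulrBl.
rewrite (sum_norm2 (fun i => bump i x - bump i x.+1) (fun j => bump j y)).
have -> : 12 * w%:R = 2 * (6 * w%:R) :> R by ring.
by apply: ler_pM; rewrite ?sumr_ge0 ?bump_norm_sum ?bump_diff_sum.
Qed.

Lemma bump2_right x y : fdist bump2 x y x y.+1 <= 12 * w%:R.
Proof.
rewrite /fdist /bump2; under eq_bigr do rewrite -mulrBr.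
rewrite (sum_norm2 (fun i => bump i x) (fun j => bump j y - bump j y.+1)).
have -> : 12 * w%:R = (6 * w%:R) * 2 :> R by ring.
by apply: ler_pM; rewrite ?sumr_ge0 ?bump_norm_sum ?bump_diff_sum.
Qed.

(** Since each bump has zero sum, only the diagonal remains, which has fewer terms by a factor of
    order [n]. *)
Lemma bump2_offdiag k : \sum_(x : 'I_n) \sum_(y : 'I_n | x != y) bump2 k x y =
  - \sum_(x : 'I_n) bump2 k x x.
Proof.
rewrite -sumrN; apply: eq_bigr => x _; rewrite -mulr_sumr -mulrN; congr (_ * _).
under eq_bigl do rewrite eq_sym.
by rewrite (sum_neq1 (fun y => bump k.2 y)) bump_sum sub0r.
Qed.

(** The constant comes from the product of two sums of size 6w in the sup and sum bounds, where one
    [w] is traded for [n]; unit moves need only 12w. *)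
Lemma tame_bump2 : tame n (36 * w%:R) bump2.
Proof.
split=> [x y _ _ _|x y _ _ _ _|x y _ _ _ _|x _|].
- apply: le_trans (bump2_norm_sum x y) _; have := wnR; have := w1; nra.
- apply: le_trans (bump2_left x y) _; have := w1; lra.
- apply: le_trans (bump2_right x y) _; have := w1; lra.
(* The path may cross the diagonal, because the unit move bounds of [bump2] hold at equal positions
   too. *)
- apply: le_trans (fdist_trans _ x.+1 x.+1 _ _ _ _) _.
  have := bump2_left x x.+1; have := bump2_right x.+1 x.
  rewrite (fdistC _ _ _ x.+1 x); have := w1; lra.
- under eq_bigr do rewrite bump2_offdiag normrN.
  apply: (@le_trans _ _ (\sum_k \sum_(x : 'I_n) `|bump2 k x x|)).
    by apply: ler_sum => k _; exact: ler_norm_sum.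
  rewrite exchange_big /=.
  apply: (@le_trans _ _ (\sum_(x : 'I_n) 36 * w%:R * w%:R)).
    by apply: ler_sum => x _; exact: bump2_norm_sum.
  rewrite sum_cst expr2 -!mulrA; apply: ler_wpM2l => //.
  have : w%:R * w%:R <= n%:R * w%:R :> R by rewrite ler_wpM2r.
  lra.
Qed.

Lemma sqr_sum (a : 'I_n -> R) :
  (\sum_i a i) ^+ 2 = \sum_i a i ^+ 2 + \sum_(k | k.1 != k.2) a k.1 * a k.2.
Proof.
rewrite expr2 big_distrlr /=.
rewrite -(pair_big_dep xpredT (fun i j => i != j) (fun i j => a i * a j)) /= -big_split /=.
apply: eq_bigr => i _; rewrite (bigD1 i) //=; congr (_ + _).
by apply: eq_bigl => j; rewrite eq_sym.
Qed.

Definition stat v : R := \sum_(i : 'I_n) bump i (v i).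

(** 291 = 3 + 8 * 36: the diagonal uses the exact uniformity of touched cards, the rest
    [touched_pairs]. *)
Lemma touched_sqr s t :
  avg s t (fun v A => (\sum_(i : 'I_n) (i \in A)%:R * bump i (v i)) ^+ 2) <= 291 * w%:R.
Proof.
have q0 : 0 <= stay R n ^+ t by rewrite exprn_ge0 ?stay_ge0.
have q1 : stay R n ^+ t <= 1 by rewrite exprn_ile1 ?stay_ge0 ?stay_le1.
have -> : avg s t (fun v A => (\sum_(i : 'I_n) (i \in A)%:R * bump i (v i)) ^+ 2) =
  \sum_(i : 'I_n) avg s t (fun v A => (i \in A)%:R * bump i (v i) ^+ 2)
  + \sum_(k : 'I_n * 'I_n | k.1 != k.2)
      avg s t (fun v A => (k.1 \in A)%:R * (k.2 \in A)%:R * bump2 k (v k.1) (v k.2)).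
  rewrite -!avg_sum -avgD; apply: eq_avg => v A; rewrite sqr_sum; congr (_ + _).
    by apply: eq_bigr => i _; case: (i \in A); rewrite ?mul1r // !mul0r expr0n.
  by apply: eq_bigr => k _; rewrite /bump2 mulrACA.
have -> : 291 * w%:R = 3 * w%:R + 8 * (36 * w%:R) :> R by ring.
apply: lerD.
  apply: (@le_trans _ _ (\sum_(i : 'I_n) 3 * w%:R / n%:R)); last first.
    by rewrite sum_cst mulrC divfK.
  apply: ler_sum => i _; rewrite (avg_touched s t i (fun x => bump i x ^+ 2)).
  rewrite mulrAC ler_pM2r ?invr_gt0 ?ltr0n; last by lia.
  have := bump_sqr_sum i; set S := \sum_(x : _) _ => S3.
  have S0 : 0 <= S by apply: sumr_ge0 => x _; exact: sqr_ge0.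
  by apply: le_trans S3; rewrite ler_piMl // gerBl.
apply: le_trans (ler_norm _) _.
apply: le_trans (touched_pairs n2 _ _ s t tame_bump2) _.
by rewrite ler_piMr ?gerBl // !mulr_ge0.
Qed.

(** Chebyshev in pointwise form: the indicator is at least 1 minus the squared displacement over
    w^2. The walk starts at the identity because the window of card [i] is centred at [i]. *)
Lemma untouched_mean t :
  untouched_count R n t * (1 - (3 * t%:R / w%:R ^+ 2 + 3 * w%:R / n%:R))
  <= avg 1%g t (fun v A => \sum_(i : 'I_n) (i \notin A)%:R * bump i (v i)).
Proof.
rewrite avg_sum /untouched_count -mulrA -sum_cst; apply: ler_sum => i _.
set q := stay R n ^+ t; set W : R := w%:R ^+ 2.
have W0 : 0 < W by rewrite exprn_gt0 // ltr0n.
pose D (v : {perm 'I_n}) : R := ((v i)%:R - ((1%g : {perm 'I_n}) i)%:R) ^+ 2.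
apply: (@le_trans _ _ (avg 1%g t (fun v A => (1 - 3 * w%:R / n%:R) * (i \notin A)%:R
     + (- W^-1) * ((i \notin A)%:R * D v)))).
  rewrite avgD !avgZ avg_untouched -/q.
  have := @avg_untouched_drift R n 1%g t i; rewrite -/q -/(D _) => h.
  have : W^-1 * avg 1%g t (fun v A => (i \notin A)%:R * D v) <= W^-1 * (3 * t%:R * q).
    by apply: ler_wpM2l => //; rewrite invr_ge0 ltW.
  set a := W^-1 * avg _ _ _; rewrite mulNr -/a => h'.
  have -> : q * (1 - (3 * t%:R / W + 3 * w%:R / n%:R)) =
     (1 - 3 * w%:R / n%:R) * q - W^-1 * (3 * t%:R * q) by ring.
  lra.
apply: avg_le => v A; case: (i \in A) => /=; first by rewrite !(mulr0, mul0r) addr0.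
rewrite mulr1 !mul1r mulNr /bump.
have := close_freq_le i.
suff : 1 - W^-1 * D v <= (close_to i (v i))%:R by lra.
have D0 : 0 <= W^-1 * D v by rewrite mulr_ge0 ?sqr_ge0 // invr_ge0 ltW.
case h : (close_to i (v i)) => /=; first lra.
suff : 1 <= W^-1 * D v by lra.
rewrite mulrC ler_pdivlMr // mul1r /W /D perm1 -[leRHS]real_normK ?num_real //.
rewrite ler_pXn2r ?nnegrE // .
move: h; rewrite /close_to; case: (leqP (v i) (i + w)) => /= h1 h2.
  have : (v i)%:R + w%:R <= i%:R :> R by rewrite -natrD ler_nat; lia.
  by have := w1; rewrite -normrN ler_normr => ? ?; apply/orP; left; lra.
have : i%:R + w%:R <= (v i)%:R :> R by rewrite -natrD ler_nat; lia.
by have := w1; rewrite ler_normr => ? ?; apply/orP; left; lra.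
Qed.

(** Bumps are at most 1 in absolute value, so the number of untouched cards dominates;
    [avg_untouched2] bounds its pair terms. *)
Lemma untouched_sqr s t :
  avg s t (fun v A => (\sum_(i : 'I_n) (i \notin A)%:R * bump i (v i)) ^+ 2)
    <= untouched_count R n t + untouched_count R n t ^+ 2.
Proof.
set M := untouched_count R n t; have q0 : 0 <= stay R n ^+ t by rewrite exprn_ge0 ?stay_ge0.
apply: (@le_trans _ _ (avg s t (fun v A => \sum_(i : 'I_n) (i \notin A)%:R
   + \sum_(k : 'I_n * 'I_n | k.1 != k.2) ((k.1 \notin A) && (k.2 \notin A))%:R))).
  apply: avg_le => v A; rewrite sqr_sum; apply: lerD; apply: ler_sum => i _.
    case: (i \in A) => /=; first by rewrite mul0r expr0n.
    by rewrite mul1r bump_sqr_le1.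
  case: (_ \in A) => /=; first by rewrite !mul0r.
  case: (_ \in A) => /=; first by rewrite mul0r mulr0.
  rewrite !mul1r; have := bump_sqr_le1 i.1 (v i.1); have := bump_sqr_le1 i.2 (v i.2).
  have := sqr_ge0 (bump i.1 (v i.1) - bump i.2 (v i.2)); nra.
rewrite avgD !avg_sum; apply: lerD.
  rewrite (eq_bigr (fun=> stay R n ^+ t)) => [|i _]; last exact: avg_untouched.
  by rewrite sum_cst.
apply: (@le_trans _ _ (\sum_(k : 'I_n * 'I_n) stay R n ^+ (2 * t))).
  rewrite big_mkcond; apply: ler_sum => -[i j] _ /=.
  case: eqP => [_|/eqP ij] /=; first by rewrite exprn_ge0 ?stay_ge0.
  exact: avg_untouched2.
rewrite sumr_const card_prod card_ord -[leLHS]mulr_natl natrM /M /untouched_count exprMn mulnC exprM.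
by rewrite -expr2.
Qed.

Lemma stat_walk t (M := untouched_count R n t) :
  avg 1%g t (fun v _ => (stat v - M) ^+ 2)
   <= 2 * M + 4 * (3 * t%:R / w%:R ^+ 2 + 3 * w%:R / n%:R) * M ^+ 2 + 582 * w%:R.
Proof.
pose U (v : {perm 'I_n}) A : R := \sum_(i : 'I_n) (i \notin A)%:R * bump i (v i).
pose T (v : {perm 'I_n}) A : R := \sum_(i : 'I_n) (i \in A)%:R * bump i (v i).
(* From (x + y)^2 <= 2x^2 + 2y^2 with x = U - M. In the mean of 2x^2 the M^2 terms cancel, except
   for the relative loss in the mean of [U]. *)
apply: (@le_trans _ _ (avg 1%g t (fun v A => 2 * U v A ^+ 2 + (- 4 * M) * U v A
    + 2 * M ^+ 2 + 2 * T v A ^+ 2))).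
  apply: avg_le => v A; have -> : stat v = U v A + T v A.
    rewrite -big_split; apply: eq_bigr => i _; case: (i \in A) => /=; ring.
  have := sqr_ge0 (U v A - M - T v A); nra.
rewrite !avgD avg_const; last by lia.
rewrite !avgZ.
set e := 3 * t%:R / w%:R ^+ 2 + 3 * w%:R / n%:R.
have M0 : 0 <= M by rewrite /M /untouched_count mulr_ge0 ?exprn_ge0 ?stay_ge0.
have mU : M * (M * (1 - e)) <= M * avg 1%g t U.
  by apply: ler_wpM2l => //; exact: untouched_mean.
have sU : avg 1%g t (fun v A => U v A ^+ 2) <= M + M ^+ 2 := untouched_sqr 1%g t.
have sT : avg 1%g t (fun v A => T v A ^+ 2) <= 291 * w%:R := touched_sqr 1%g t.
lra.
Qed.

Lemma sum_perm1 (f : 'I_n -> R) (i : 'I_n) :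
  \sum_(u : {perm 'I_n}) f (u i) = #|{perm 'I_n}|%:R / n%:R * \sum_x f x.
Proof.
apply: (mulfI n0').
transitivity (\sum_(k : 'I_n) \sum_(u : {perm 'I_n}) f (u k)).
  rewrite -sum_cst; apply: eq_bigr => k _.
  rewrite (reindex_inj (mulgI (tperm k i))); apply: eq_bigr => u _.
  by rewrite permM tpermR.
rewrite exchange_big; under eq_bigr do rewrite sum_perm_reindex.
by rewrite sumr_const -[LHS]mulr_natl; field.
Qed.

(** A transposition replaces [j] by any [k] other than [i], and the values [g (u k)] over these [k]
    sum to [- g (u i)]. *)
Lemma sum_perm2 (f g : 'I_n -> R) (i j : 'I_n) : i != j -> \sum_x g x = 0 ->
  (n%:R - 1) * \sum_(u : {perm 'I_n}) f (u i) * g (u j) =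
    - (#|{perm 'I_n}|%:R / n%:R * \sum_x f x * g x).
Proof.
move=> ij g0.
transitivity (\sum_(k | k != i) \sum_(u : {perm 'I_n}) f (u i) * g (u k)).
  transitivity (\sum_(k | k != i) \sum_(u : {perm 'I_n}) f (u i) * g (u j)).
    by rewrite sum_neq1 sum_cst; ring.
  apply: eq_bigr => k ki; rewrite [RHS](reindex_inj (mulgI (tperm k j))).
  by apply: eq_bigr => u _; rewrite !permM tpermL tpermD // eq_sym.
rewrite exchange_big -(sum_perm1 (fun x => f x * g x) i) -sumrN; apply: eq_bigr => u _.
by rewrite -mulr_sumr (sum_neq1 (fun k => g (u k))) sum_perm_reindex g0 sub0r mulrN.
Qed.

(** 75 = 3 + 72: the diagonal gives 3w, and the pairs give 36w^2/(n-1), at most 72w since w <= n <=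
    2(n-1). *)
Lemma stat_unif :
  \sum_(u : {perm 'I_n}) stat u ^+ 2 <= #|{perm 'I_n}|%:R * (75 * w%:R).
Proof.
set C : R := #|_|%:R; have C0 : 0 <= C by [].
under eq_bigr do rewrite /stat sqr_sum.
rewrite big_split /= exchange_big [X in _ + X]exchange_big /=.
have -> : C * (75 * w%:R) = C * (3 * w%:R) + C * (72 * w%:R) by ring.
apply: lerD.
  apply: (@le_trans _ _ (\sum_(i : 'I_n) C / n%:R * (3 * w%:R))).
    apply: ler_sum => i _; rewrite (sum_perm1 (fun x => bump i x ^+ 2)).
    by apply: ler_wpM2l; rewrite ?divr_ge0 // bump_sqr_sum.
  by rewrite sum_cst le_eqVlt; apply/orP; left; apply/eqP; field.
have N1 : 0 < n%:R - 1 :> R by have := n3; lra.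
rewrite -(ler_pM2l N1) mulr_sumr.
apply: (@le_trans _ _ (\sum_(k : 'I_n * 'I_n) C / n%:R * \sum_(x : 'I_n) `|bump2 k x x|)).
  rewrite big_mkcond; apply: ler_sum => -[i j] _ /=.
  case: eqP => [_|/eqP ij] /=.
    by rewrite mulr_ge0 ?divr_ge0 ?sumr_ge0.
  rewrite (sum_perm2 (fun x => bump i x) (fun x => bump j x)) ?bump_sum // -mulrN.
  apply: ler_wpM2l; first by rewrite divr_ge0.
  apply: le_trans (ler_norm _) _; rewrite normrN; exact: ler_norm_sum.
rewrite -mulr_sumr exchange_big /=.
apply: (@le_trans _ _ (C / n%:R * \sum_(x : 'I_n) 36 * w%:R * w%:R)).
  apply: ler_wpM2l; first by rewrite divr_ge0.
  by apply: ler_sum => x _; exact: bump2_norm_sum.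
rewrite sum_cst.
have -> : C / n%:R * (n%:R * (36 * w%:R * w%:R)) = C * (36 * w%:R * w%:R) by field.
rewrite [leRHS]mulrCA; apply: ler_wpM2l => //.
have := wnR; have := w1; have := n3; nra.
Qed.

End Statistic.

(** * Total variation from second moments *)

Section TotalVariation.
Context {R : realType} {n : nat}.
Implicit Types (s u : {perm 'I_n}) (f : {perm 'I_n} -> R).

Lemma rtr_law_ge0 s t u : 0 <= rtr_law R s t u.
Proof.
elim: t u => [|t IH] u /=; first exact: ler0n.
by apply: sumr_ge0 => v _; rewrite mulr_ge0 // /rtr_kernel divr_ge0.
Qed.

Lemma rtr_law_sum s t : (0 < n)%N -> \sum_u rtr_law R s t u = 1.
Proof.
move=> n0; rewrite -(avg_const s t (1 : R) n0) -lawE.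
by under [RHS]eq_bigr do rewrite mulr1.
Qed.

Lemma perm_inv_sum : \sum_(u : {perm 'I_n}) (#|{perm 'I_n}|%:R)^-1 = 1 :> R.
Proof.
rewrite sumr_const -[LHS]mulr_natl mulfV // pnatr_eq0 -lt0n.
by apply/card_gt0P; exists 1%g.
Qed.

Lemma tv_le1 s t : (0 < n)%N -> tv_to_unif (rtr_law R s t) <= 1.
Proof.
move=> n0; rewrite /tv_to_unif mulrC ler_pdivrMr // mul1r.
apply: (@le_trans _ _ (\sum_(u : {perm 'I_n}) (rtr_law R s t u + (#|{perm 'I_n}|%:R)^-1))).
  apply: ler_sum => u _; apply: le_trans (ler_normB _ _) _.
  by rewrite !ger0_norm ?rtr_law_ge0 ?invr_ge0.
by rewrite big_split /= rtr_law_sum // perm_inv_sum; lra.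
Qed.

(* Pointwise, min(m, c) <= 4 / M^2 * (m (f - M)^2 + c f^2), because f cannot be
   close to both 0 and M. *)
Lemma tv_lower s t f (M : R) : (0 < n)%N -> 0 < M ->
  1 - 4 / M ^+ 2 * (avg s t (fun v _ => (f v - M) ^+ 2)
                    + (#|{perm 'I_n}|%:R)^-1 * \sum_u f u ^+ 2)
   <= tv_to_unif (rtr_law R s t).
Proof.
move=> n0 M0; rewrite /tv_to_unif [leRHS]mulrC ler_pdivlMr // -lawE.
set a := 4 / M ^+ 2; set c := _^-1.
(* Since |m - c| = m + c - 2 min(m, c) and both laws sum to 1, it suffices to bound the minimum
   termwise. *)
apply: (@le_trans _ _ (\sum_u (rtr_law R s t u + c
    - a * (rtr_law R s t u * (f u - M) ^+ 2 + c * f u ^+ 2) * 2))).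
  rewrite !(big_split, sumrN) /= rtr_law_sum // [\sum_u c]perm_inv_sum -mulr_suml -mulr_sumr.
  by rewrite big_split /= -mulr_sumr; lra.
apply: ler_sum => u _; set m := rtr_law R s t u.
have m0 : 0 <= m by exact: rtr_law_ge0.
have c0 : 0 <= c by rewrite invr_ge0.
have P (x y z : R) : 0 <= x -> 0 <= y -> M ^+ 2 <= 4 * y -> 0 <= z ->
    x <= 4 / M ^+ 2 * (x * y + z).
  move=> x0 y0 h z0; rewrite mulrAC ler_pdivlMr ?exprn_gt0 //.
  have := ler_wpM2l x0 h; lra.
have [h|h] := lerP (M / 2) (f u).
  have := P c (f u ^+ 2) (m * (f u - M) ^+ 2) c0 (sqr_ge0 _).
  have -> : M ^+ 2 <= 4 * f u ^+ 2.
    have : 0 <= (2 * f u - M) * (2 * f u + M) by apply: mulr_ge0; lra.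
    lra.
  rewrite mulr_ge0 ?sqr_ge0 // => /(_ isT isT).
  rewrite -/a => h1; have := ler_norm (m - c); lra.
have := P m ((f u - M) ^+ 2) (c * f u ^+ 2) m0 (sqr_ge0 _).
have -> : M ^+ 2 <= 4 * (f u - M) ^+ 2.
  have : 0 <= (M - 2 * f u) * (3 * M - 2 * f u) by apply: mulr_ge0; lra.
  lra.
rewrite mulr_ge0 ?sqr_ge0 // => /(_ isT isT); rewrite -/a => h1.
have := ler_norm (c - m); rewrite distrC; lra.
Qed.

Lemma rtr_dist_le1 t : (0 < n)%N -> rtr_dist R n t <= 1.
Proof. by move=> n0; apply: bigmax_le => // s _; exact: tv_le1. Qed.

(** The start at the identity bounds the maximum from below; 2628 = 4 (582 + 75) collects the noise
    of the touched cards and of the uniform law. *)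
Lemma rtr_dist_lower (w t : nat) (M := untouched_count R n t) :
  (2 < n)%N -> (0 < w)%N -> (w <= n)%N ->
  1 - (8 / M + 16 * (3 * t%:R / w%:R ^+ 2 + 3 * w%:R / n%:R) + 2628 * w%:R / M ^+ 2)
   <= rtr_dist R n t.
Proof.
move=> n2 w0 wn.
have n3 : 3 <= n%:R :> R by rewrite ler_nat.
have M0 : 0 < M.
  rewrite /M /untouched_count mulr_gt0 ?exprn_gt0 //; first lra.
  rewrite /stay subr_gt0 invf_lt1; lra.
apply: (@le_trans _ _ (tv_to_unif (rtr_law R (1%g : {perm 'I_n}) t))); last exact: le_bigmax.
apply: le_trans (tv_lower 1%g t (stat w) M _ M0); last by lia.
rewrite lerD2l lerN2.
have C0 : 0 < #|{perm 'I_n}|%:R :> R by rewrite ltr0n; apply/card_gt0P; exists 1%g.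
have h1 : avg 1%g t (fun v : {perm 'I_n} => fun=> (stat w v - M) ^+ 2)
   <= 2 * M + 4 * (3 * t%:R / w%:R ^+ 2 + 3 * w%:R / n%:R) * M ^+ 2 + 582 * w%:R.
  exact: stat_walk.
have h2 : (#|{perm 'I_n}|%:R)^-1 * \sum_(u : {perm 'I_n}) stat w u ^+ 2 <= 75 * w%:R :> R.
  by rewrite ler_pdivrMl //; exact: stat_unif.
have P0 : 0 <= 4 / M ^+ 2 by rewrite divr_ge0 ?sqr_ge0.
apply: le_trans (ler_wpM2l P0 (lerD h1 h2)) _.
rewrite le_eqVlt; apply/orP; left; apply/eqP; set e := _ + 3 * _ / _.
field; lra.
Qed.

End TotalVariation.

(** * Choice of the window and passage to the limit *)

Section Asymptotics.
Context {R : realType}.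

(** Here 1/(1 - 1/n) = 1 + 1/(n-1) <= exp(1/(n-1)), and replacing n-1 by [n] in the exponent loses
    t/(n(n-1)) <= 1. *)
Lemma untouched_count_lower (n t : nat) : (1 < n)%N -> ln n%:R <= (n%:R - 1 : R) ->
  t%:R <= n%:R * ln n%:R :> R ->
  expR (ln n%:R - t%:R / n%:R - 1) <= untouched_count R n t.
Proof.
move=> n1; set N : R := n%:R; set L := ln N => LN tN.
have N1 : 2 <= N by rewrite ler_nat.
have NL : expR L = N by rewrite lnK // posrE; lra.
have hE : expR (- (N - 1)^-1) <= stay R n.
  have e : 1 + (N - 1)^-1 = (stay R n)^-1.
    rewrite /stay -/N; field; lra.
  rewrite expRN -[leRHS]invrK -e lef_pV2 ?posrE ?expR_gt0 ?expR_ge1Dx //.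
  rewrite addr_gt0 // invr_gt0; lra.
rewrite /untouched_count -/N.
apply: (@le_trans _ _ (N * expR (- (N - 1)^-1) ^+ t)); last first.
  by rewrite ler_wpM2l ?lerXn2r ?nnegrE ?expR_ge0 ?stay_ge0 //; lra.
have -> : N * expR (- (N - 1)^-1) ^+ t = expR (L + - (N - 1)^-1 * t%:R).
  by rewrite expRD NL expRM_natr.
rewrite ler_expR.
suff : t%:R / (N - 1) <= t%:R / N + 1 by lra.
have -> : t%:R / (N - 1) = t%:R / N + t%:R / (N * (N - 1)) by field; lra.
rewrite lerD2l ler_pdivrMr; last by rewrite mulr_gt0; lra.
by rewrite mul1r; apply: le_trans tN _; rewrite ler_wpM2l //; lra.
Qed.

Lemma rtr_dist_lower_exp (n t : nat) (c : R) (L := ln (n%:R : R)) :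
  40 <= L -> 0 <= c ->
  t%:R = 3/4 * n%:R * L - 1/4 * n%:R * ln L - c * n%:R ->
  1 - ((5256 * expR 2 + 8 * expR 1 + 48) * expR (- c)
       + 96 * expR (3/2) * expR (- (L / 16))) <= rtr_dist R n t.
Proof.
move=> L40 c0; set l := ln L; set N : R := n%:R => tE.
have n0 : (0 < n)%N.
  by case: posnP => // n0; move: L40; rewrite /L n0 ln0 //; lra.
have N0 : 0 < N by rewrite ltr0n.
have NL : expR L = N by rewrite lnK.
have Ll : expR l = L by rewrite lnK // posrE; lra.
have LN : L <= N - 1 by have := expR_ge1Dx L; rewrite NL; lra.
have n2 : (2 < n)%N by rewrite -(ltr_nat R) -/N; lra.
have l0 : 0 <= l by rewrite ln_ge0 //; lra.
(* Chosen so that 3/8 of this bound is L/16 + 3/2, as used for W / N. *)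
have lL : l <= L / 6 + 4.

  have := expR_ge1Dx (l - 4); rewrite expRD Ll expRN.
  have e4 : 6 <= expR 4 :> R.
    have -> : 4 = 2%:R * 2 :> R by ring.
    rewrite expRM_natl; have := expR_ge1Dx (2 : R); nra.
  have : L * (expR 4)^-1 <= L * 6^-1.
    by rewrite ler_wpM2l ?lef_pV2 ?posrE ?expR_gt0 //; lra.
  lra.
have tN : t%:R / N = 3/4 * L - 1/4 * l - c by rewrite tE; field; lra.
have tL : t%:R <= N * L by rewrite -ler_pdivrMl // mulrC tN; lra.
(* Nonnegativity of [t] bounds [c] from above, which keeps the window small compared with [N]. *)
have t0 : 0 <= 3/4 * L - 1/4 * l - c by rewrite -tN divr_ge0.
pose W : R := expR (c / 2 + L / 2 + l / 2).
have W1 : 1 <= W by have := expR_ge1Dx (c / 2 + L / 2 + l / 2); rewrite -/W; lra.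
pose d : R := expR (3/2) * expR (- (L / 16)).
(* With L >= 40 the exponent in [d] is at most 3/2 - 40/16 = -1. This makes the window fit into the
   deck. *)
have d2 : 2 * d <= 1.
  have e1 : 2 <= expR 1 :> R by have := expR_ge1Dx (1 : R); lra.
  have : d <= expR (-1) by rewrite /d -expRD ler_expR; lra.
  have : (expR 1)^-1 <= 2^-1 :> R by rewrite lef_pV2 ?posrE ?expR_gt0 //; lra.
  rewrite expRN; lra.
have WN : W / N <= d by rewrite -NL -expRN -expRD /d -expRD ler_expR; lra.
pose w := (Num.truncn W).+1.
have /andP[wW Ww] := truncn_itv (le_trans ler01 W1).
have wW2 : w%:R <= 2 * W by rewrite /w -natr1; lra.
have {Ww} Ww : W <= w%:R by exact: ltW.
have WdN : W <= d * N by rewrite -ler_pdivrMr.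
have wn : (w <= n)%N by rewrite -(ler_nat R) -/N; apply: le_trans wW2 _; nra.
pose M := untouched_count R n t.
have ML : expR (L / 4 + l / 4 + c - 1) <= M.
  apply: (@le_trans _ _ (expR (L - t%:R / N - 1))); first by rewrite ler_expR tN; lra.
  exact: (untouched_count_lower n t (ltnW n2) LN tL).
have M0 : 0 < M by apply: lt_le_trans ML; exact: expR_gt0.
apply: le_trans (rtr_dist_lower w t n2 (ltn0Sn _) wn).
rewrite lerD2l lerN2 -/M -/N.
have h1 : 8 / M <= 8 * expR 1 * expR (- c).
  rewrite -mulrA ler_wpM2l // -expRD -[leRHS]invrK -expRN lef_pV2 ?posrE ?expR_gt0 //.
  by apply: le_trans ML; rewrite ler_expR; lra.
have h2 : 3 * t%:R / w%:R ^+ 2 <= 3 * expR (- c).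
  rewrite -mulrA ler_wpM2l //.
  apply: (@le_trans _ _ (t%:R / W ^+ 2)).
    by rewrite ler_wpM2l // lef_pV2 ?posrE ?exprn_gt0 ?lerXn2r ?nnegrE //; lra.
  rewrite ler_pdivrMr ?exprn_gt0 ?expR_gt0 // /W -expRM_natl -expRD.
  have -> : - c + 2%:R * (c / 2 + L / 2 + l / 2) = L + l by field.
  by rewrite expRD NL Ll.
have h3 : 3 * w%:R / N <= 6 * d.
  rewrite ler_pdivrMr //; lra.
(* The powers of n and log n cancel exactly: both [W] and M^2 carry sqrt(n log n), with factors
   e^(c/2) and e^(2c-2). This fixes the threshold. *)
have h4 : w%:R / M ^+ 2 <= 2 * (expR 2 * expR (- c)).
  apply: (@le_trans _ _ (2 * W / expR (L / 4 + l / 4 + c - 1) ^+ 2)).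
    apply: ler_pM; rewrite ?invr_ge0 ?sqr_ge0 //.
    by rewrite lef_pV2 ?posrE ?exprn_gt0 ?expR_gt0 ?lerXn2r ?nnegrE ?expR_ge0 // ltW.
  rewrite -mulrA ler_wpM2l // /W -expRM_natl -expRN -!expRD ler_expR; lra.
rewrite /d in h3; lra.
Qed.

End Asymptotics.

Theorem theorem1 (R : realType) (t : nat -> nat) (c : nat -> R) :
  c @ \oo --> +oo ->
  (\forall n \near \oo,
     (t n)%:R = 3/4 * n%:R * ln n%:R - 1/4 * n%:R * ln (ln n%:R) - c n * n%:R) ->
  (fun n => rtr_dist R n (t n)) @ \oo --> (1 : R).
Proof.
move=> cy tE.
have ln_y : (fun n : nat => ln n%:R : R) @ \oo --> +oo.
  apply/cvgryPge => A; near=> n.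
  rewrite -[A]expRK ler_ln ?posrE ?expR_gt0 //; last first.
    by rewrite ltr0n; near: n; exact: nbhs_infty_gt.
  by near: n; exact: nbhs_infty_ger.
have expN0 (u : nat -> R) : u @ \oo --> +oo -> (fun n => expR (- u n)) @ \oo --> (0 : R).
  by move=> uy; exact: (cvg_comp _ _ uy (@cvgr_expR R)).
have ln16 : (fun n : nat => ln n%:R / 16 : R) @ \oo --> +oo.
  apply/cvgryPge => A; near=> n.
  rewrite ler_pdivlMr //; near: n; exact: (cvgry_ge ln_y).
pose K : R := 5256 * expR 2 + 8 * expR 1 + 48.
pose K' : R := 96 * expR (3/2).
apply: (squeeze_cvgr (f := fun n => 1 - (K * expR (- c n) + K' * expR (- (ln n%:R / 16))))
                     (h := fun=> 1)); last exact: cvg_cst.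
  near=> n; apply/andP; split; last first.
    by apply: rtr_dist_le1; near: n; exact: nbhs_infty_gt.
  apply: rtr_dist_lower_exp.
  - by near: n; exact: (cvgry_ge ln_y).
  - by near: n; exact: (cvgry_ge cy).
  - by near: n; exact: tE.
have : (fun n => 1 - (K * expR (- c n) + K' * expR (- (ln n%:R / 16)))) @ \oo
         --> 1 - (K * 0 + K' * 0).
  apply: cvgB; first exact: cvg_cst.
  by apply: cvgD; (apply: cvgM; first exact: cvg_cst); exact: expN0.
by rewrite !mulr0 addr0 subr0.
Unshelve. all: by end_near.
Qed.
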